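(* Let $d\geq2$ be an integer, $\alpha\in(0,d-1)$, $\beta>0$, and assume that $\beta\geq\beta_*$, where $\beta_*=\frac{6d+2+\alpha(d-1)}{d-1-\alpha}$. Then $$\varepsilon(m)=\begin{cases}\varepsilon_2(m)&\text{if }m\in[0,m_{2,3}],\\ \varepsilon_3(m)&\text{if }m\in[m_{2,3},m_*],\\ 0&\text{if }m\geq m_*.\end{cases}$$ The function $\varepsilon(m)$ is increasing for $m\in[0,m_2^c]$ and decreasing for $m\in[m_2^c,m_*]$. The previous points are ordered as $0<m_2^c<m_{2,3}<m_*$.
   Context: $\omega_n$ denotes the volume of the unit ball in $\mathbb{R}^n$, $B_1$ the unit ball of $\mathbb{R}^d$, and $\mathcal{J}_\sigma(E):=\int_E\int_E|x-y|^\sigma\,\mathrm{d}x\,\mathrm{d}y$ for $\sigma>-d$. Let $\lambda_k=k(k+d-2)$ for $k\geq1$ and, for $\sigma>-(d-1)$ and $k\geq1$, $$\mu_k(\sigma):=(d-1)\omega_{d-1}2^{d-1+\sigma}\,\frac{\Gamma\left(\frac{d-1+\sigma}{2}\right)\Gamma\left(\frac{d-1}{2}\right)}{\Gamma\left(\frac{2d-2+\sigma}{2}\right)}\left[1-\prod_{j=0}^{k-1}\frac{j-\frac{\sigma}{2}}{j+d-1+\frac{\sigma}{2}}\right].$$ Set $r=\frac{d-\alpha+1}{d}$, $q=\frac{\alpha+\beta}{d}$, and for $k\geq2$ $$A_k=\frac{\mu_k(-\alpha)-\mu_1(-\alpha)}{\lambda_k-\lambda_1},\qquad B_k=\frac{\mu_1(\beta)-\mu_k(\beta)}{\lambda_k-\lambda_1},\qquad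 \varepsilon_k(m)=m^r\left(A_k-B_km^q\right)\quad(m\geq0)$$ (the numbers $A_k$, $B_k$ are strictly positive). Set also $\varepsilon_1(m)\equiv0$ and $\varepsilon(m):=\sup_{k\geq1}\varepsilon_k(m)$ for $m\geq0$. The point $m_2^c:=\left(\frac{rA_2}{(r+q)B_2}\right)^{1/q}$ is the maximum point of $\varepsilon_2$, and $m_{2,3}:=\left(\frac{A_2-A_3}{B_2-B_3}\right)^{1/q}$ is the nonzero intersection point of the curves $\varepsilon_2$ and $\varepsilon_3$. For $\beta\geq\beta_*$ the constant $m_*$ is $$m_*=\left(\frac{\alpha(d-\alpha)(2d+2+\beta)}{\beta(d+\beta)(2d+2-\alpha)}\cdot\frac{\mathcal{J}_{-\alpha}(B_1)}{\mathcal{J}_\beta(B_1)}\right)^{\frac{d}{\alpha+\beta}}.$$ *)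

(* Defs.v *)
From HB Require Import structures.
From mathcomp Require Import all_boot all_order all_algebra.
From mathcomp Require Import all_classical all_reals all_analysis.

Set Implicit Arguments.
Unset Strict Implicit.
Unset Printing Implicit Defensive.

Import Order.TTheory GRing.Theory Num.Theory.
Import numFieldNormedType.Exports.

Local Open Scope classical_set_scope.
Local Open Scope ring_scope.

(* Points of R^n are n-tuples of reals; on tuples the library puts the
   sigma-algebra generated by the coordinates, i.e. the Borel sets of R^n. *)
Notation Rn R n := (n.-tuple (measurableTypeR R)).

Section lebesgue_measure_succ.
Local Open Scope ereal_scope.
Context (R : realType) (n : nat).

Definition consRn (p : measurableTypeR R * Rn R n) : Rn R n.+1 :=
  [tuple of p.1 :: p.2].

Lemma measurable_consRn : measurable_fun setT consRn.
Proof. exact: measurable_cons. Qed.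

Lemma measurable_consRn_preimage (A : set (Rn R n.+1)) :
  measurable A -> measurable (consRn @^-1` A).
Proof. by move=> mA; rewrite -[X in measurable X]setTI; exact: measurable_consRn. Qed.

Variable m : {sigma_finite_measure set (Rn R n) -> \bar R}.

Definition lebesgue_measure_succ : set (Rn R n.+1) -> \bar R :=
  pushforward (lebesgue_measure \x m) consRn.

Let mu0 : lebesgue_measure_succ set0 = 0.
Proof. by rewrite /lebesgue_measure_succ /pushforward preimage_set0 measure0. Qed.

Let mu_ge0 A : 0 <= lebesgue_measure_succ A.
Proof. by rewrite /lebesgue_measure_succ /pushforward; exact: measure_ge0. Qed.

Let mu_sigma_additive : semi_sigma_additive lebesgue_measure_succ.
Proof.
move=> F mF tF mUF; rewrite /lebesgue_measure_succ /pushforward preimage_bigcup.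
apply: measure_semi_sigma_additive.
- by move=> k; exact: measurable_consRn_preimage.
- apply/trivIsetP => /= i j _ _ ij; rewrite -preimage_setI.
  by move/trivIsetP : tF => /(_ _ _ _ _ ij) ->//; rewrite preimage_set0.
- by rewrite -preimage_bigcup; exact: measurable_consRn_preimage.
Qed.

HB.instance Definition _ := isMeasure.Build _ _ _
  lebesgue_measure_succ mu0 mu_ge0 mu_sigma_additive.

Let mu_sigma_finite : sigma_finite setT lebesgue_measure_succ.
Proof.
have /sigma_finiteP[F [TF ndF Foo]] := @sigma_finiteT _ _ _ (@lebesgue_measure R).
have /sigma_finiteP[G [TG ndG Goo]] := sigma_finiteT m.
pose split_Rn (t : Rn R n.+1) : measurableTypeR R * Rn R n :=
  (thead t, [tuple of behead t]).
have msplit : measurable_fun setT split_Rn.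
  apply/measurable_fun_pairP; split; first exact: measurable_tnth.
  exact: measurable_behead.
have splitK : cancel consRn split_Rn.
  by case=> x t; congr pair; apply: val_inj.
exists (fun k => split_Rn @^-1` (F k `*` G k)).
  rewrite -preimage_bigcup (_ : \bigcup_k _ = setT) ?preimage_setT//.
  apply/seteqP; split => // -[x y] _.
  have [k _ Fx] : (\bigcup_k F k) x by rewrite -TF.
  have [l _ Gy] : (\bigcup_k G k) y by rewrite -TG.
  exists (maxn k l) => //; split.
    by move: x Fx; exact/subsetPset/ndF/leq_maxl.
  by move: y Gy; exact/subsetPset/ndG/leq_maxr.
move=> k; have [mF Fk] := Foo k; have [mG Gk] := Goo k; split.
  by rewrite -[X in measurable X]setTI; apply: msplit => //; exact: measurableX.
rewrite /lebesgue_measure_succ /pushforward -comp_preimage.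
rewrite (_ : _ \o _ = id) ?preimage_id; last exact/funext.
by rewrite product_measure1E// lte_mul_pinfty// ge0_fin_numE.
Qed.

HB.instance Definition _ := Measure_isSigmaFinite.Build _ _ _
  lebesgue_measure_succ mu_sigma_finite.

End lebesgue_measure_succ.

(* Lebesgue measure on R^n: the n-fold product of the Lebesgue measure of R
   (on R^0, the unit mass at the only point). *)
Fixpoint lebesgue_Rn (R : realType) (n : nat) :
    {sigma_finite_measure set (Rn R n) -> \bar R} :=
  match n with
  | 0 => [the {sigma_finite_measure set (Rn R 0) -> \bar R} of
            dirac ([tuple] : Rn R 0)]
  | n'.+1 => [the {sigma_finite_measure set (Rn R n'.+1) -> \bar R} of
            lebesgue_measure_succ (lebesgue_Rn R n')]
  end.

Section geometry.
Context {R : realType}.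

(* The library's norm on vectors is the sup norm, hence this one. *)
Definition norm2 n (x : Rn R n) : R := Num.sqrt (\sum_(i < n) tnth x i ^+ 2).

Definition dist2 n (x y : Rn R n) : R :=
  Num.sqrt (\sum_(i < n) (tnth x i - tnth y i) ^+ 2).

Definition unit_ball n : set (Rn R n) := [set x | norm2 x < 1].

Definition omega n : R := fine (lebesgue_Rn R n (@unit_ball n)).

(* On the diagonal (a null set) [powR 0 sigma] is 0 for [sigma != 0]. *)
Definition calJ n (sigma : R) (E : set (Rn R n)) : R :=
  fine (\int[lebesgue_Rn R n]_(x in E) \int[lebesgue_Rn R n]_(y in E)
          (dist2 x y `^ sigma)%:E)%E.

(* Euler's integral, meaningful for x > 0. *)
Definition Gamma (x : R) : R :=
  (\int[lebesgue_measure]_(t in `]0%R, +oo[) (t `^ (x - 1) * expR (- t)))%R.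

End geometry.

Section epsilon.
Context {R : realType}.
Variable d : nat.

Definition lambda (k : nat) : R := k%:R * (k%:R + d%:R - 2).

Definition mu (k : nat) (sigma : R) : R :=
  (d%:R - 1) * omega d.-1 * 2 `^ (d%:R - 1 + sigma) *
  (Gamma ((d%:R - 1 + sigma) / 2) * Gamma ((d%:R - 1) / 2)
     / Gamma ((2 * d%:R - 2 + sigma) / 2)) *
  (1 - \prod_(j < k) ((j%:R - sigma / 2) / (j%:R + d%:R - 1 + sigma / 2))).

Variables alpha beta : R.

Definition r_exp : R := (d%:R - alpha + 1) / d%:R.

Definition q_exp : R := (alpha + beta) / d%:R.

Definition A_ (k : nat) : R :=
  (mu k (- alpha) - mu 1 (- alpha)) / (lambda k - lambda 1).

Definition B_ (k : nat) : R :=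
  (mu 1 beta - mu k beta) / (lambda k - lambda 1).

Definition eps_ (k : nat) (m : R) : R :=
  if k == 1%N then 0 else m `^ r_exp * (A_ k - B_ k * m `^ q_exp).

(* The supremum is taken in the extended reals, so that finiteness is part of
   any equation between [eps m] and a real number. *)
Definition eps (m : R) : \bar R :=
  ereal_sup [set (eps_ k m)%:E | k in [set k | (1 <= k)%N]].

Definition m2c : R :=
  ((r_exp * A_ 2) / ((r_exp + q_exp) * B_ 2)) `^ q_exp^-1.

Definition m23 : R := ((A_ 2 - A_ 3) / (B_ 2 - B_ 3)) `^ q_exp^-1.

Definition beta_star : R :=
  (6 * d%:R + 2 + alpha * (d%:R - 1)) / (d%:R - 1 - alpha).

Definition m_star : R :=
  (alpha * (d%:R - alpha) * (2 * d%:R + 2 + beta) /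
     (beta * (d%:R + beta) * (2 * d%:R + 2 - alpha)) *
   (calJ (- alpha) (@unit_ball R d) / calJ beta (@unit_ball R d)))
  `^ (d%:R / (alpha + beta)).

End epsilon.

(* Main.v *)
Require Import Defs.
From HB Require Import structures.
From mathcomp Require Import all_boot all_order all_algebra.
From mathcomp Require Import all_classical all_reals all_analysis.
From mathcomp Require Import measurable_realfun.
From mathcomp Require Import ring lra.

(** Write [D = d], [a = alpha / 2], [x = beta / 2].

    Up to a positive factor independent of [k], [A_ k] is
    [(1 - Q k) / ((k - 1) * (k + D - 1))] and [B_ k] is
    [(1 - p k) / ((k - 1) * (k + D - 1))], where [Q] and [p] are explicit
    finite products of rational functions.  Everything about the envelope
    follows from three facts about these numbers.

    - [A_ k <= A_ 3] for [k >= 3]: the decrements of [Q] decrease, so their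
      averages do ([attr_prod_average]).
    - [A_ k / B_ k <= A_ 3 / B_ 3] for [k >= 3] ([spectral_ratio]): the curves
      from the fourth one on vanish no later than the third.  This is where
      the threshold [beta_star] enters, being exactly the condition
      [Q 3 <= `|p 3|].  The ratio of the decrements of [`|p|] and [Q] rises and
      then falls; hence, if the inequality failed once, the failure would
      persist and would contradict [p k -> 0].
    - [m_star ^ q = A_ 3 / B_ 3] ([A3_B3_energy]): both the energies
      [calJ sigma] of the ball and the constants [mu k sigma] are quotients of
      Gamma values, related by [Gamma (z + 1) = z * Gamma z].

    With [t = A_ k / A_ 3] in [[0, 1]] the first two facts give
    [A_ k - B_ k * M <= t * (A_ 3 - B_ 3 * M)] for [M >= 0], so that beyond
    the second curve only the third one matters before [m_star], and nothing
    but [0] after it.  Since [A_ 3 / A_ 2] and [B_ 3 / B_ 2] are simple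
    fractions, the [q]-th powers of [m2c], [m23] and [m_star] are explicit
    multiples of [A_ 2 / B_ 2], which orders them; moreover the third curve
    attains its maximum exactly at [m23], so it decreases from there on.
    Monotonicity of a single curve [m ^ r * (A - B * m ^ q)] is concavity in
    the variable [m ^ r].

    The energy of the ball is computed without polar coordinates.  By symmetry
    it is twice the part [norm2 y < norm2 x].  There [z = x - y] ranges over
    [norm2 z ^ 2 < 2 * dot x z], and averaging over dilations ([mellin]) turns
    this into a Gaussian integral over the half-space [0 < dot x z].  A
    Gaussian integral of a function of [dot x z] depends only on [norm2 x]
    ([gauss_projection]), which leaves one-dimensional Gamma integrals. *)

Set Implicit Arguments.
Unset Strict Implicit.
Unset Printing Implicit Defensive.

Import Order.TTheory GRing.Theory Num.Theory.
Import numFieldNormedType.Exports.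

Local Open Scope classical_set_scope.
Local Open Scope ring_scope.

(** * Euclidean operations on tuples and their measurability *)

Section euclidean.
Context {R : realType}.

Lemma measurable_fun_natr d (T : measurableType d) (b : T -> bool) :
  measurable_fun setT b -> measurable_fun setT (fun x => (b x)%:R : R).
Proof.
move=> mb; rewrite (_ : (fun x => _) = (fun x => if b x then 1 else 0)).
  exact: measurable_fun_ifT.
by apply/funext => x; case: (b x).
Qed.

Definition affine n (c : R) (a x : Rn R n) : Rn R n :=
  [tuple c * tnth x i + tnth a i | i < n].

Lemma measurable_affine n c a : measurable_fun [set: Rn R n] (affine c a).
Proof.
apply/measurable_fun_tnthP => i.
rewrite (_ : _ \o _ = fun x => c * tnth x i + tnth a i); last first.
  by apply/funext => x /=; rewrite tnth_mktuple.
apply: measurable_funD => //; apply: measurable_funM => //.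
exact: measurable_tnth.
Qed.

Definition dot n (a x : Rn R n) : R := \sum_(i < n) tnth a i * tnth x i.

Lemma norm2_sqr n (x : Rn R n) : norm2 x ^+ 2 = \sum_(i < n) tnth x i ^+ 2.
Proof. by rewrite sqr_sqrtr// sumr_ge0// => i _; exact: sqr_ge0. Qed.

Lemma norm2_ge0 n (x : Rn R n) : 0 <= norm2 x. Proof. exact: sqrtr_ge0. Qed.

Lemma norm2_cons n x0 (x : Rn R n) :
  norm2 [tuple of x0 :: x] ^+ 2 = x0 ^+ 2 + norm2 x ^+ 2.
Proof.
rewrite !norm2_sqr big_ord_recl tnth0; congr (_ + _).
by apply: eq_bigr => i _; rewrite tnthS.
Qed.

Lemma dot_cons n a0 x0 (a x : Rn R n) :
  dot [tuple of a0 :: a] [tuple of x0 :: x] = a0 * x0 + dot a x.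
Proof.
rewrite /dot big_ord_recl !tnth0; congr (_ + _).
by apply: eq_bigr => i _; rewrite !tnthS.
Qed.

Definition scaleRn n (c : R) (x : Rn R n) : Rn R n := [tuple c * tnth x i | i < n].

Lemma scaleRnE n c (x : Rn R n) : scaleRn c x = affine c [tuple 0 | i < n] x.
Proof. by apply: eq_from_tnth => i; rewrite !tnth_mktuple addr0. Qed.

Lemma scaleRnA n c e (x : Rn R n) : scaleRn c (scaleRn e x) = scaleRn (c * e) x.
Proof. by apply: eq_from_tnth => i; rewrite !tnth_mktuple mulrA. Qed.

Lemma scale1Rn n (x : Rn R n) : scaleRn 1 x = x.
Proof. by apply: eq_from_tnth => i; rewrite !tnth_mktuple mul1r. Qed.

Lemma norm2_scale n c (x : Rn R n) : norm2 (scaleRn c x) = `|c| * norm2 x.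
Proof.
rewrite /norm2 -sqrtr_sqr -sqrtrM ?sqr_ge0// mulr_sumr; congr Num.sqrt.
by apply: eq_bigr => i _; rewrite tnth_mktuple exprMn.
Qed.

Lemma dot_scale n c (a x : Rn R n) : dot a (scaleRn c x) = c * dot a x.
Proof.
by rewrite /dot mulr_sumr; apply: eq_bigr => i _; rewrite tnth_mktuple mulrCA.
Qed.

Lemma norm2_eq0 n (x : Rn R n) : norm2 x = 0 -> x = scaleRn 0 x.
Proof.
move=> x0; have : \sum_(i < n) tnth x i ^+ 2 = 0 by rewrite -norm2_sqr x0 expr0n.
move/eqP; rewrite psumr_eq0 => [/allP xi0|i _]; last exact: sqr_ge0.
apply: eq_from_tnth => i; rewrite tnth_mktuple mul0r.
by have := xi0 i (mem_index_enum _); rewrite sqrf_eq0 => /eqP.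
Qed.

Lemma norm2_sub n (x z : Rn R n) :
  norm2 (affine (-1) x z) ^+ 2 = norm2 x ^+ 2 - 2 * dot x z + norm2 z ^+ 2.
Proof.
rewrite !norm2_sqr /dot mulr_sumr -sumrB -big_split/=; apply: eq_bigr => i _.
by rewrite tnth_mktuple; ring.
Qed.

(** [affine (-1) x z] is [x - z]: this is the substitution that recentres a
    potential at [x]. *)
Lemma dist2_sub n (x z : Rn R n) : dist2 x (affine (-1) x z) = norm2 z.
Proof.
rewrite /dist2 /norm2; congr Num.sqrt; apply: eq_bigr => i _.
by rewrite tnth_mktuple; ring.
Qed.

Lemma dist2C n (x y : Rn R n) : dist2 x y = dist2 y x.
Proof.
rewrite /dist2; congr Num.sqrt; apply: eq_bigr => i _.
by rewrite -sqrrN opprB.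
Qed.

Lemma measurable_norm2 n : measurable_fun [set: Rn R n] (@norm2 R n).
Proof.
have -> : @norm2 R n = fun x => (\sum_(i < n) tnth x i ^+ 2) `^ 2^-1.
  apply/funext => x; rewrite powR12_sqrt// sumr_ge0// => i _; exact: sqr_ge0.
refine (@measurableT_comp _ _ _ _ _ _ (fun y => powR y 2^-1) setT _ (measurable_powR _) _).
apply: measurable_sum => i; apply: measurable_funX; exact: measurable_tnth.
Qed.

Lemma measurable_dot n (a : Rn R n) : measurable_fun [set: Rn R n] (dot a).
Proof.
apply: measurable_sum => i; apply: measurable_funM => //; exact: measurable_tnth.
Qed.

Lemma measurable_dist2 n :
  measurable_fun [set: Rn R n * Rn R n] (fun z => dist2 z.1 z.2).
Proof.
have -> : (fun z : Rn R n * Rn R n => dist2 z.1 z.2) =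
    fun z => (\sum_(i < n) (tnth z.1 i - tnth z.2 i) ^+ 2) `^ 2^-1.
  apply/funext => x; rewrite powR12_sqrt// sumr_ge0// => i _; exact: sqr_ge0.
refine (@measurableT_comp _ _ _ _ _ _ (fun y => powR y 2^-1) setT _ (measurable_powR _) _).
apply: measurable_sum => i; apply: measurable_funX; apply: measurable_funB.
- exact (measurableT_comp (@measurable_tnth _ _ _ i) measurable_fst).
- exact (measurableT_comp (@measurable_tnth _ _ _ i) measurable_snd).
Qed.

Lemma measurable_scaleRn d (T : measurableType d) n (c : T -> R) (x : T -> Rn R n) :
  measurable_fun setT c -> measurable_fun setT x ->
  measurable_fun setT (fun z => scaleRn (c z) (x z)).
Proof.
move=> mc mx; apply/measurable_fun_tnthP => i.
rewrite (_ : _ \o _ = fun z => c z * tnth (x z) i); last first.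
  by apply/funext => z /=; rewrite tnth_mktuple.
apply: measurable_funM => //.
exact (measurableT_comp (@measurable_tnth _ _ _ i) mx).
Qed.

End euclidean.

Lemma measurable_fun_lteif (R : realType) d (T : measurableType d) (C : bool)
    (f g : T -> R) : measurable_fun setT f -> measurable_fun setT g ->
  measurable_fun setT (fun x => f x < g x ?<= if C).
Proof.
by case: C => mf mg; [exact: measurable_fun_ler|exact: measurable_fun_ltr].
Qed.

Lemma measurable_fun_dist2 (R : realType) d (T : measurableType d) n
    (f g : T -> Rn R n) : measurable_fun setT f -> measurable_fun setT g ->
  measurable_fun setT (fun x => dist2 (f x) (g x)).
Proof.
move=> mf mg.
exact (measurableT_comp (@measurable_dist2 R n) (measurable_fun_pair mf mg)).
Qed.

Ltac measurability :=
  repeat lazymatch goal with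
  | |- measurable_fun _ (fun x => EFin (@?f x)) => refine ((measurable_EFinP setT f).2 _)
  | |- measurable_fun _ (fun x => @GRing.mul _ (@?f x) (@?g x)) =>
      refine (@measurable_funM _ _ _ _ f g _ _)
  | |- measurable_fun _ (fun x => @GRing.add _ (@?f x) (@GRing.opp _ (@?g x))) =>
      refine (@measurable_funB _ _ _ _ f g _ _)
  | |- measurable_fun _ (fun x => @GRing.add _ (@?f x) (@?g x)) =>
      refine (@measurable_funD _ _ _ _ f g _ _)
  | |- measurable_fun _ (fun x => @GRing.opp _ (@?f x)) =>
      refine (@measurable_funN _ _ _ _ f _)
  | |- measurable_fun _ (fun x => @GRing.exp _ (@?f x) ?n) =>
      refine (@measurable_funX _ _ _ _ f n _)
  | |- measurable_fun _ (fun x => ((nat_of_bool (@?f x))%:R)) =>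
      refine (@measurable_fun_natr _ _ _ f _)
  | |- measurable_fun _ (fun x => @Order.lt _ _ (@?f x) (@?g x)) =>
      refine (@measurable_fun_ltr _ _ _ _ f g _ _)
  | |- measurable_fun _ (fun x => @Order.le _ _ (@?f x) (@?g x)) =>
      refine (@measurable_fun_ler _ _ _ _ f g _ _)
  | |- measurable_fun _ (fun x => andb (@?f x) (@?g x)) =>
      refine (@measurable_and _ _ _ f g _ _)
  | |- measurable_fun _ (fun x => powR (@?f x) ?p) =>
      refine (@measurableT_comp _ _ _ _ _ _ (fun y => powR y p) setT f (measurable_powR p) _)
  | |- measurable_fun _ (fun x => expR (@?f x)) =>
      refine (@measurableT_comp _ _ _ _ _ _ expR setT f (@measurable_expR _) _)
  | |- measurable_fun _ (fun x => Order.lteif (@?f x) (@?g x) ?C) =>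
      refine (@measurable_fun_lteif _ _ _ C f g _ _)
  | |- measurable_fun _ (fun x => dist2 (@?f x) (@?g x)) =>
      refine (@measurable_fun_dist2 _ _ _ _ f g _ _)
  | |- measurable_fun _ (fun x => norm2 (@?f x)) =>
      refine (@measurableT_comp _ _ _ _ _ _ (@norm2 _ _) setT f (@measurable_norm2 _ _) _)
  | |- measurable_fun _ (fun x => dot ?a (@?f x)) =>
      refine (@measurableT_comp _ _ _ _ _ _ (dot a) setT f (@measurable_dot _ _ a) _)
  | |- measurable_fun _ (fun x => scaleRn (@?c x) (@?f x)) =>
      refine (@measurable_scaleRn _ _ _ _ c f _ _)
  | |- measurable_fun _ (scaleRn ?c) =>
      refine (@measurable_scaleRn _ _ _ _ (fun=> c) (fun x => x) _ _)
  | |- measurable_fun _ (dot _) => exact: measurable_dot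
  | |- measurable_fun _ (@norm2 _ _) => exact: measurable_norm2
  | |- measurable_fun _ (fun x => fst x) => exact: measurable_fst
  | |- measurable_fun _ (fun x => snd x) => exact: measurable_snd
  | |- measurable_fun _ (fun x => x) => exact: measurable_id
  | |- measurable_fun _ (fun x => ?c) => exact: measurable_cst
  end.

(** * One-variable integrals *)

Section one_variable.
Context {R : realType}.
Notation mR := (measurableTypeR R).
Notation leb := (@lebesgue_measure R).

Lemma integral_bool d (T : measurableType d) (m : {measure set T -> \bar R})
    (D : set T) (b : T -> bool) (f : T -> R) : (forall x, D x <-> b x) ->
  (\int[m]_(x in D) (f x)%:E = \int[m]_x ((b x)%:R * f x)%:E)%E.
Proof.
move=> Db; rewrite integral_mkcond; apply: eq_integral => x _.
rewrite patchE; case: ifPn => xD.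
  by move: xD; rewrite inE => /Db ->; rewrite mul1r.
case: (boolP (b x)) => [/Db xb|]; last by rewrite mul0r.
by move: xD; rewrite mem_set.
Qed.

Arguments integral_bool {d T} m D {b f}.

(** Lebesgue measure is the only measure that gives half-open intervals their
    length, and [`|c|] times the image of Lebesgue measure does. *)
Lemma ge0_integral_affine (c a : R) (f : R -> \bar R) : c != 0 ->
  measurable_fun [set: R] f -> (forall x, 0 <= f x)%E ->
  (\int[leb]_x f (c * x + a)%R = (`|c|^-1)%:E * \int[leb]_x f x)%E.
Proof.
move=> c0 mf f0; pose phi : mR -> mR := fun x => c * x + a.
have mphi : measurable_fun [set: mR] phi.
  by apply: measurable_funD => //; exact: mulrl_measurable.
pose k : {nonneg R} := NngNum (normr_ge0 c).
pose nu : {measure set mR -> \bar R} := mscale k (measure_function_pushforward__canonical__measure_function_Measure leb mphi).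
have lebE A : measurable A -> leb A = nu A.
  move=> mA; apply: lebesgue_measure_unique => // _ [[u v]] _ <-.
  rewrite (_ : nu _ = (`|c|%:E * leb (phi @^-1` `]u, v]%classic))%E)//.
  have [clt0|cgt0|c00] := ltgtP c 0; last by rewrite c00 eqxx in c0.
    rewrite (_ : _ @^-1` _ = `[(v - a) / c, (u - a) / c[%classic); last first.
      apply/seteqP; split => x /=; rewrite !in_itv/= /phi ler_ndivrMr//.
        by move=> /andP[ux xv]; rewrite ltr_ndivlMr// mulrC; apply/andP; split; lra.
      by rewrite ltr_ndivlMr// mulrC => /andP[ux xv]; apply/andP; split; lra.
    rewrite !lebesgue_measure_itv/= !lte_fin ltr_ndivrMr// divfK// ltrD2r.
    case: ifPn => uv; rewrite ?mule0// ltr0_norm// -!EFinD -EFinM; congr EFin.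
    by field.
  rewrite (_ : _ @^-1` _ = `](u - a) / c, (v - a) / c]%classic); last first.
    apply/seteqP; split => x /=; rewrite !in_itv/= /phi ltr_pdivrMr//.
      by move=> /andP[ux xv]; rewrite ler_pdivlMr// mulrC; apply/andP; split; lra.
    by rewrite ler_pdivlMr// mulrC => /andP[ux xv]; apply/andP; split; lra.
  rewrite !lebesgue_measure_itv/= !lte_fin ltr_pdivrMr// divfK// ltrD2r.
  case: ifPn => uv; rewrite ?mule0// gtr0_norm// -!EFinD -EFinM; congr EFin.
  by field.
rewrite [in RHS](eq_measure_integral nu); last first.
  by move=> A mA _; exact: lebE.
rewrite ge0_integral_mscale//= muleA -EFinM mulVf ?normr_eq0// mul1e.
by rewrite ge0_integral_pushforward.
Qed.

Lemma cvg_powRN_y (b : R) : 0 < b -> x `^ (- b) @[x --> +oo] --> (0 : R).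
Proof.
move=> b0; apply/cvgrPdist_le => e e0; near=> x.
have ex : e `^ (- b^-1) < x by near: x; exact: nbhs_pinfty_gt.
have x0 : 0 < x by apply: le_lt_trans ex; exact: powR_ge0.
rewrite sub0r normrN ger0_norm ?powR_ge0// powRN.
rewrite -[leRHS]invrK lef_pV2 ?posrE ?invr_gt0 ?powR_gt0//.
rewrite [leLHS](_ : _ = (e `^ (- b^-1)) `^ b); last first.
  by rewrite -powRrM mulNr mulVf ?gt_eqF// powRN powRr1// ltW.
by rewrite ge0_ler_powR ?ltW ?nnegrE ?powR_ge0// ltW.
Unshelve. all: by end_near. Qed.

(** Both the strict and the large inequality occur, because the square of the
    ball is cut along [norm2 x = norm2 y] into two disjoint parts. *)
Lemma integral_powR_tail (b c : R) : 0 < b -> 0 < c ->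
  (\int[leb]_t ((c < t)%R%:R * t `^ (- b - 1))%:E = (c `^ (- b) / b)%:E)%E /\
  (\int[leb]_t ((c <= t)%R%:R * t `^ (- b - 1))%:E = (c `^ (- b) / b)%:E)%E.
Proof.
move=> b0 c0; have bn0 : b != 0 by rewrite gt_eqF.
have pos x : c <= x -> x \in `]0, +oo[.
  by move=> cx; rewrite in_itv/= andbT (lt_le_trans c0).
have dF x : c <= x -> derivable (fun t : R => - b^-1 * t `^ (- b)) x 1.
  by move=> cx; apply: derivableM; [exact: derivable_cst|apply: derivable_powR; exact: pos].
have E : (\int[leb]_(t in `[c, +oo[) (t `^ (- b - 1))%:E = (c `^ (- b) / b)%:E)%E.
  rewrite (@ge0_continuous_FTC2y _ _ (fun t => - b^-1 * t `^ (- b)) c 0).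
  - by rewrite add0e -EFinN; congr EFin; field; rewrite gt_eqF.
  - by move=> x _; exact: powR_ge0.
  - apply: derivable_within_continuous => x; rewrite in_itv/= andbT => cx.
    by apply: derivable_powR; exact: pos.
  - rewrite -(mulr0 (- b^-1)); apply: cvgM; first exact: cvg_cst.
    exact: cvg_powRN_y.
  - by move=> x /ltW; exact: dF.
  - apply: cvg_at_right_filter.
    have /derivable1_diffP/differentiable_continuous := dF c (lexx c); exact.
  - move=> x; rewrite in_itv/= andbT => /ltW cx.
    rewrite derive1Ml; last by apply: derivable_powR; exact: pos.
    by rewrite powR_derive1 ?pos// mulrA mulrNN mulVf// mul1r.
split.
- rewrite -(integral_bool leb (`]c, +oo[%classic)).
    rewrite integral_itv_obnd_cbnd//.
    apply/measurable_EFinP/measurable_funTS; exact: measurable_powR.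
  by move=> x /=; rewrite in_itv/= andbT.
- rewrite -(integral_bool leb (`[c, +oo[%classic))//.
  by move=> x /=; rewrite in_itv/= andbT.
Qed.

Lemma integral_expR_tail (t a : R) : 0 < t ->
  (\int[leb]_u ((a < u)%R%:R * expR (- (t * u)))%:E = (expR (- (t * a)) / t)%:E)%E.
Proof.
move=> t0.
have dE (x : R) : is_derive x 1 (fun u : R => expR (- (t * u))) (- t * expR (- (t * x))).
  apply: is_derive_eq; by rewrite /GRing.scale/= mulr1 mulrC.
have cE : continuous (fun u : R => expR (- (t * u))).
  move=> x; apply/differentiable_continuous/derivable1_diffP.
  by have [] := dE x.
rewrite -(integral_bool leb (`]a, +oo[%classic)); last first.
  by move=> x /=; rewrite in_itv/= andbT.
rewrite integral_itv_obnd_cbnd; last first.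
  apply/measurable_EFinP/measurable_funTS; exact: continuous_measurable_fun.
have dF (x : R) : is_derive x 1 (fun u : R => - t^-1 * expR (- (t * u))) (expR (- (t * x))).
  apply: is_derive_eq; by rewrite /GRing.scale/= mulrA mulrNN mulVf ?gt_eqF// mul1r.
rewrite (@ge0_continuous_FTC2y _ _ (fun u => - t^-1 * expR (- (t * u))) a 0).
- by rewrite add0e -EFinN; congr EFin; field; rewrite gt_eqF.
- by move=> x _; exact: expR_ge0.
- exact: continuous_subspaceT.
- rewrite -(mulr0 (- t^-1)); apply: cvgM; first exact: cvg_cst.
  rewrite (_ : (fun x => expR (- (t * x))) =
               (fun z => expR (- z)) \o (fun z => t * z)); last by [].
  apply: (@cvg_comp _ _ _ _ _ _ (pinfty_nbhs R)); last exact: cvgr_expR.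
  exact: gt0_cvgMry.
- by move=> x _; have [] := dF x.
- apply: cvg_at_right_filter.
  have [/derivable1_diffP/differentiable_continuous + _] := dF a; exact.
- by move=> x _; rewrite derive1E; have [_ ->] := dF x.
Qed.

End one_variable.
Arguments integral_bool {R d T} m D {b f}.

(** * Euler's Gamma function *)

Section gamma_function.
Context {R : realType}.
Notation leb := (@lebesgue_measure R).

Lemma gt0_powRD (a u v : R) : 0 < a -> a `^ (u + v) = a `^ u * a `^ v.
Proof. by move=> a0; rewrite powRD// (gt_eqF a0) implybT. Qed.

(** Taking values in the extended reals, this form of the integral can be
    computed with before it is known to be finite. *)
Definition gamma (x : R) : \bar R :=
  (\int[leb]_t ((0 < t)%R%:R * (t `^ (x - 1) * expR (- t)))%:E)%E.

Lemma GammaE (x : R) : Gamma x = fine (gamma x).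
Proof.
rewrite /Gamma /Rintegral /gamma -(integral_bool leb (`]0, +oo[%classic))//.
by move=> t /=; rewrite in_itv/= andbT.
Qed.

Lemma gamma_ge0 (x : R) : (0 <= gamma x)%E.
Proof.
by apply: integral_ge0 => t _; rewrite lee_fin !mulr_ge0 ?powR_ge0 ?expR_ge0.
Qed.

Lemma integral_gamma_scale (x s : R) : 0 < s ->
  (\int[leb]_t ((0 < t)%R%:R * (t `^ (x - 1) * expR (- (s * t))))%:E =
   (s `^ (- x))%:E * gamma x)%E.
Proof.
move=> s0; pose g t : \bar R := ((0 < t)%R%:R * (t `^ (x - 1) * expR (- t)))%:E.
have g0 t : (0 <= g t)%E.
  by rewrite lee_fin !mulr_ge0 ?powR_ge0 ?expR_ge0.
have mg : measurable_fun [set: R] g by rewrite /g; measurability.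
have := @ge0_integral_affine R s 0 g (lt0r_neq0 s0) mg g0.
rewrite -/(gamma x) gtr0_norm// => /(congr1 (fun u => (s `^ (1 - x))%:E * u)%E).
rewrite muleA -EFinM.
rewrite [in X in _ = (X%:E * _)%E -> _](_ : s `^ (1 - x) * s^-1 = s `^ (- x)); last first.
  by rewrite gt0_powRD// powRr1 ?ltW// mulrAC divff ?gt_eqF// mul1r.
move=> <-; rewrite -ge0_integralZl_EFin//; last 2 first.
- by apply: (measurableT_comp mg); measurability.
- exact: powR_ge0.
apply: eq_integral => t _; rewrite /g addr0 -EFinM; congr EFin.
rewrite pmulr_rgt0//; case: ltP => t0; last by rewrite !mul0r mulr0.
rewrite !mul1r powRM ?ltW// mulrA mulrA -gt0_powRD//.
by rewrite (_ : 1 - x + (x - 1) = 0) ?powRr0 ?mul1r//; ring.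
Qed.

(** Since [expR (- t) / t] is the integral of [expR (- (t * s))] over [s > 1],
    exchanging integrals and scaling [t] by [s] leaves the integral of
    [s `^ (- x - 1)], namely [x^-1]; no boundary term at [0] appears, as it
    would in an integration by parts. *)
Lemma gammaD1 (x : R) : 0 < x -> (gamma (x + 1) = x%:E * gamma x)%E.
Proof.
move=> x0.
pose F (z : R * R) := ((1 < z.2)%R%:R * ((0 < z.1)%R%:R * (z.1 `^ x * expR (- (z.2 * z.1))))).
have F0 z : (0 <= (F z)%:E)%E.
  by rewrite lee_fin !mulr_ge0 ?powR_ge0 ?expR_ge0.
have mF : measurable_fun setT (EFin \o F) by rewrite /comp /F; measurability.
have := @fubini_tonelli _ _ _ _ R leb leb (EFin \o F) mF F0.
have -> : (\int[leb]_t \int[leb]_s (EFin \o F) (t, s) = gamma x)%E.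
  apply: eq_integral => t _; rewrite /F/=.
  case: ltP => t0; last first.
    by rewrite mul0r; apply: integral0_eq => s _; rewrite mul0r mulr0.
  under eq_integral.
    move=> s _; rewrite mul1r mulrCA [s * t]mulrC EFinM; over.
  rewrite ge0_integralZl_EFin//; last 2 first.
  - by measurability.
  - exact: powR_ge0.
  rewrite integral_expR_tail// mulr1 -EFinM mul1r; congr EFin.
  by rewrite gt0_powRD// powRN powRr1 ?ltW// mulrAC mulrA.
have -> : (\int[leb]_s \int[leb]_t (EFin \o F) (t, s) =
           (x^-1)%:E * gamma (x + 1))%E.
  under eq_integral.
    move=> s _; rewrite /F/=.
    under eq_integral do rewrite EFinM.
    rewrite ge0_integralZl_EFin//; last 2 first.
    - by move=> t _; rewrite lee_fin !mulr_ge0 ?powR_ge0 ?expR_ge0.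
    - by measurability.
    rewrite (_ : (_ * _)%E = ((1 < s)%R%:R * s `^ (- x - 1))%:E * gamma (x + 1))%E; last first.
      case: ltP => s1; last by rewrite !mul0r !mul0e.
      rewrite !mul1r mul1e; have s0 : 0 < s by apply: lt_trans s1.
      have := integral_gamma_scale (x + 1) s0.
      by rewrite addrK opprD.
    over.
  rewrite ge0_integralZr//; last 3 first.
  - by measurability.
  - by move=> s _; rewrite lee_fin mulr_ge0 ?powR_ge0.
  - exact: gamma_ge0.
  by have [-> _] := @integral_powR_tail R x 1 x0 ltr01; rewrite powR1 mul1r.
by move=> ->; rewrite muleA -EFinM divff ?gt_eqF// mul1e.
Qed.

Lemma gamma1 : gamma 1 = 1%E.
Proof.
have := @integral_expR_tail R 1 0 ltr01.
rewrite mulr0 oppr0 expR0 divr1 => <-; apply: eq_integral => t _.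
by rewrite subrr powRr0 !mul1r.
Qed.

Lemma gammaS_fact n : gamma n.+1%:R = (n`!%:R)%:E.
Proof.
elim: n => [|n IHn]; first by rewrite gamma1.
by rewrite -natr1 gammaD1// IHn -EFinM factS natrM.
Qed.

(** For [x >= 1], [t `^ (x - 1) <= 1 + t ^+ n] with [n >= x - 1], and the values
    at integers are factorials; the functional equation brings [x > 0] back to
    this case. *)
Lemma gamma_lty (x : R) : 0 < x -> (gamma x < +oo)%E.
Proof.
suff H y : 1 <= y -> (gamma y < +oo)%E.
  move=> x0; have : (gamma (x + 1) < +oo)%E by apply: H; rewrite lerDr ltW.
  rewrite gammaD1//; case: (gamma x) (gamma_ge0 x) => [r _ _|_|//].
    exact: ltry.
  by rewrite mulry gtr0_sg// mul1e.
move=> y1; pose n := Num.truncn y.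
have ny : y - 1 <= n%:R by rewrite lerBlDr natr1 ltW// truncnS_gt.
apply: (@le_lt_trans _ _ (gamma 1 + gamma n.+1%:R)%E); last first.
  by rewrite gamma1 gammaS_fact lte_add_pinfty ?ltry.
have g0 z t : (0 <= ((0 < t)%R%:R * (t `^ (z - 1) * expR (- t)))%:E :> \bar R)%E.
  by rewrite lee_fin !mulr_ge0 ?powR_ge0 ?expR_ge0.
have -> : (gamma 1 + gamma n.+1%:R = \int[leb]_t
    (((0 < t)%R%:R * (t `^ (1 - 1) * expR (- t)))%:E +
     ((0 < t)%R%:R * (t `^ (n.+1%:R - 1) * expR (- t)))%:E))%E.
  by apply/esym/ge0_integralD => // [|]; measurability.
apply: ge0_le_integral => //=.
- by measurability.
- by apply: emeasurable_funD; measurability.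
move=> t _; rewrite -EFinD lee_fin -mulrDr -mulrDl.
case: ltP => [t0|_]; last by rewrite !mul0r.
rewrite !mul1r ler_wpM2r ?expR_ge0// subrr powRr0 -natr1 addrK.
have [t1|/ltW t1] := leP 1 t.
  by apply: (le_trans (ler_powR t1 ny)); rewrite lerDr.
have t01 : 0 < t <= 1 by rewrite t0.
apply: (@le_trans _ _ 1); last by rewrite lerDl powR_ge0.
by rewrite -[leRHS](powRr0 t); apply: ger_powR => //; rewrite subr_ge0.
Qed.

(** On [[1, 2]] the integrand has a positive lower bound. *)
Lemma gamma_gt0 (x : R) : (0 < gamma x)%E.
Proof.
pose c : R := (2 `^ `|x - 1|)^-1 * expR (- 2).
have c0 : 0 < c by rewrite mulr_gt0 ?invr_gt0 ?powR_gt0 ?expR_gt0.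
have : (\int[leb]_(t in `[1%R, 2%R]) c%:E <= gamma x)%E.
  rewrite (integral_bool leb _ (b := fun t => (1 <= t) && (t <= 2))); last first.
    by move=> t; rewrite /= in_itv.
  apply: ge0_le_integral => //=.
  - by move=> t _; rewrite lee_fin mulr_ge0// ltW.
  - by measurability.
  - by measurability.
  move=> t _; rewrite lee_fin.
  case: (leP 1 t) => t1 /=; last by rewrite mul0r !mulr_ge0 ?powR_ge0 ?expR_ge0.
  case: (leP t 2) => t2 /=; last by rewrite mul0r !mulr_ge0 ?powR_ge0 ?expR_ge0.
  rewrite (lt_le_trans ltr01 t1) !mul1r ler_pM ?invr_ge0 ?powR_ge0 ?expR_ge0//.
    apply: (@le_trans _ _ (t `^ (- `|x - 1|))).
      rewrite powRN lef_pV2 ?posrE ?powR_gt0 ?(lt_le_trans ltr01) ?ler1n//.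
      by apply: ge0_ler_powR; rewrite ?nnegrE ?(le_trans ler01 t1) ?normr_ge0 ?ler0n.
    by apply: ler_powR => //; rewrite lerNl -normrN; exact: ler_norm.
  by rewrite ler_expR lerN2.
apply: lt_le_trans; rewrite integral_cst//= lebesgue_measure_itv/= lte_fin.
by rewrite ltr1n -EFinD -EFinM lte_fin mulr_gt0// subr_gt0 ltr1n.
Qed.

Lemma gammaK (x : R) : 0 < x -> gamma x = (Gamma x)%:E.
Proof.
by move=> x0; rewrite GammaE fineK// ge0_fin_numE ?gamma_ge0// gamma_lty.
Qed.

Lemma Gamma_gt0 (x : R) : 0 < x -> 0 < Gamma x.
Proof. by move=> x0; rewrite -lte_fin -gammaK// gamma_gt0. Qed.

Lemma GammaD1 (x : R) : 0 < x -> Gamma (x + 1) = x * Gamma x.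
Proof.
by move=> x0; apply: EFin_inj; rewrite EFinM -!gammaK ?addr_gt0// gammaD1.
Qed.

End gamma_function.

(** * Lebesgue integration on tuples *)

Section integration_on_Rn.
Context {R : realType}.
Notation leb := (@lebesgue_measure R).

Lemma measurable_integral_snd d1 d2 (T1 : measurableType d1) (T2 : measurableType d2)
    (m2 : {sigma_finite_measure set T2 -> \bar R}) (f : T1 * T2 -> \bar R) :
  measurable_fun setT f -> (forall z, 0 <= f z)%E ->
  measurable_fun setT (fun x => \int[m2]_y f (x, y))%E.
Proof. by move=> mf f0; exact: (@measurable_fun_fubini_tonelli_F _ _ _ _ R m2). Qed.

Lemma ge0_integral_Rn0 (f : Rn R 0 -> \bar R) :
  (\int[lebesgue_Rn R 0]_x f x = f [tuple])%E.
Proof.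
have mf : measurable_fun setT f.
  have -> : f = cst (f [tuple]) by apply/funext => x; rewrite (tuple0 x).
  exact: measurable_cst.
by rewrite integral_dirac// diracT mul1e.
Qed.

Lemma ge0_integral_RnS n (f : Rn R n.+1 -> \bar R) :
  measurable_fun setT f -> (forall x, 0 <= f x)%E ->
  (\int[lebesgue_Rn R n.+1]_x f x =
   \int[leb]_x \int[lebesgue_Rn R n]_t f [tuple of x :: t])%E.
Proof.
move=> mf f0.
transitivity (\int[leb \x lebesgue_Rn R n]_z (f \o @consRn R n) z)%E.
  rewrite -[RHS](ge0_integral_pushforward (@measurable_consRn R n) _ (D := setT))//.
rewrite fubini_tonelli1//; last by move=> z; exact: f0.
exact (measurableT_comp mf (@measurable_consRn R n)).
Qed.

Lemma affine_cons n c a0 (a : Rn R n) x0 (x : Rn R n) :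
  affine c [tuple of a0 :: a] [tuple of x0 :: x] =
  [tuple of c * x0 + a0 :: affine c a x].
Proof.
apply: eq_from_tnth => i; rewrite tnth_mktuple.
case: (unliftP ord0 i) => [j ->|->]; last by rewrite !tnth0.
by rewrite !tnthS tnth_mktuple.
Qed.

(** By induction on the dimension, one coordinate at a time. *)
Lemma ge0_integral_Rn_affine n (c : R) (a : Rn R n) (f : Rn R n -> \bar R) :
  c != 0 -> measurable_fun setT f -> (forall x, 0 <= f x)%E ->
  (\int[lebesgue_Rn R n]_x f (affine c a x) =
   ((`|c| ^+ n)^-1)%:E * \int[lebesgue_Rn R n]_x f x)%E.
Proof.
move=> c0; elim: n a f => [|n IHn] a f mf f0.
  rewrite !ge0_integral_Rn0 expr0 invr1 mul1e; congr f.
  by apply: eq_from_tnth => -[].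
have [[a0 a'] ->] : exists z : R * Rn R n, a = [tuple of z.1 :: z.2].
  by exists (thead a, [tuple of behead a]) => /=; rewrite -tuple_eta.
have mfc := measurableT_comp mf (@measurable_consRn R n).
rewrite !ge0_integral_RnS//; last exact (measurableT_comp mf (@measurable_affine _ _ _ _)).
pose g : R -> \bar R := fun x => (\int[lebesgue_Rn R n]_t f [tuple of x :: t])%E.
have g0 x : (0 <= g x)%E by apply: integral_ge0 => t _; exact: f0.
have mg : measurable_fun [set: R] g.
  exact (measurable_integral_snd (lebesgue_Rn R n) mfc (fun _ => f0 _)).
have mgc : measurable_fun [set: R] (fun x : R => g (c * x + a0)).
  refine (@measurableT_comp _ _ _ _ _ _ g setT (fun x => c * x + a0) mg _).
  by measurability.
have k0 : 0 <= (`|c| ^+ n)^-1 by rewrite invr_ge0 exprn_ge0.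
transitivity (\int[leb]_x (((`|c| ^+ n)^-1)%:E * g (c * x + a0)%R))%E.
  apply: eq_integral => x _; under eq_integral do rewrite affine_cons.
  rewrite (IHn a' (fun t => f [tuple of (c * x + a0) :: t]))//.
  exact (@measurable_fun_pair2 _ _ _ _ _ _ _ (c * x + a0) mfc).
rewrite (ge0_integralZl_EFin leb measurableT (fun x _ => g0 _) mgc k0).
by rewrite (ge0_integral_affine a0 c0 mg g0) muleA -EFinM exprSr invfM mulrC.
Qed.

Lemma ge0_integral_Rn_scale n (c : R) (f : Rn R n -> \bar R) :
  0 < c -> measurable_fun setT f -> (forall x, 0 <= f x)%E ->
  (\int[lebesgue_Rn R n]_x f (scaleRn c x) =
   (c `^ (- n%:R))%:E * \int[lebesgue_Rn R n]_x f x)%E.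
Proof.
move=> c0 mf f0; under eq_integral do rewrite scaleRnE.
rewrite ge0_integral_Rn_affine ?gt_eqF// gtr0_norm//.
by rewrite powRN powR_mulrn// ltW.
Qed.

End integration_on_Rn.

(** * Gaussian integrals of functions of a linear form *)

Section gaussian.
Context {R : realType}.
Notation leb := (@lebesgue_measure R).
Notation K := (Num.sqrt pi : R).

Lemma gauss_const_gt0 : 0 < K.
Proof. by rewrite sqrtr_gt0 pi_gt0. Qed.

Lemma integral_gauss_affine (c a : R) : c != 0 ->
  (\int[leb]_x (expR (- (c * x + a) ^+ 2))%:E = (`|c|^-1 * K)%:E)%E.
Proof.
move=> c0; have mg : measurable_fun [set: R] (fun x : R => (expR (- x ^+ 2))%:E).
  by measurability.
rewrite (ge0_integral_affine a c0 mg) => [|x]; last by rewrite lee_fin expR_ge0.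
by rewrite integralT_gauss.
Qed.

(** Rotation invariance of the Gaussian in the plane, by one-dimensional
    substitutions alone: put [u = a * x + b * y] for [x], complete the square
    in [y], and integrate [y] out. *)
Lemma gauss_rotation (a b : R) (h : R -> R) : 0 <= b ->
  measurable_fun setT h -> (forall t, 0 <= h t) ->
  (\int[leb]_x \int[leb]_y (expR (- x ^+ 2) * (expR (- y ^+ 2) * h (a * x + b * y)))%:E =
   K%:E * \int[leb]_t (expR (- t ^+ 2) * h (Num.sqrt (a ^+ 2 + b ^+ 2) * t))%:E)%E.
Proof.
move=> b0 mh h0; set rho := Num.sqrt (a ^+ 2 + b ^+ 2).
have mhc d (T : measurableType d) (f : T -> R) : measurable_fun setT f ->
    measurable_fun setT (fun z => h (f z)).
  by move=> mf; exact (measurableT_comp mh mf).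
have [a0|a0] := eqVneq a 0.
  have -> : rho = b by rewrite /rho a0 expr0n add0r sqrtr_sqr ger0_norm.
  have mg : measurable_fun [set: R] (fun t => (expR (- t ^+ 2) * h (b * t))%:E).
    by measurability; apply: mhc; measurability.
  have g0 t : (0 <= (expR (- t ^+ 2) * h (b * t))%:E)%E.
    by rewrite lee_fin mulr_ge0 ?expR_ge0.
  transitivity (\int[leb]_x ((expR (- x ^+ 2))%:E *
      \int[leb]_t (expR (- t ^+ 2) * h (b * t))%:E))%E.
    apply: eq_integral => x _; rewrite a0.
    under eq_integral do rewrite mul0r add0r EFinM.
    by rewrite (ge0_integralZl_EFin leb measurableT (fun t _ => g0 t) mg (expR_ge0 _)).
  rewrite ge0_integralZr//; last 2 first.
  - by measurability.
  - by apply: integral_ge0.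
  by rewrite integralT_gauss.
have rho0 : 0 < rho.
  by rewrite sqrtr_gt0 ltr_pwDl ?sqr_ge0// exprn_even_gt0.
have rho2 : rho ^+ 2 = a ^+ 2 + b ^+ 2.
  by rewrite sqr_sqrtr// addr_ge0 ?sqr_ge0.
have rhon0 : rho != 0 by rewrite gt_eqF.
pose F (z : R * R) := expR (- z.1 ^+ 2) * (expR (- z.2 ^+ 2) * h (a * z.1 + b * z.2)).
have F0 z : (0 <= (F z)%:E)%E by rewrite lee_fin !mulr_ge0 ?expR_ge0.
have mF : measurable_fun setT (EFin \o F).
  by rewrite /comp /F; measurability; apply: mhc; measurability.
rewrite (@fubini_tonelli _ _ _ _ R leb leb (EFin \o F) mF F0)/= /F/=.
pose G (z : R * R) := expR (- (a^-1 * z.1 - b / a * z.2) ^+ 2) * (expR (- z.2 ^+ 2) * h z.1).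
have G0 z : (0 <= (G z)%:E)%E by rewrite lee_fin !mulr_ge0 ?expR_ge0.
have mG : measurable_fun setT (EFin \o G).
  by rewrite /comp /G; measurability; apply: mhc; measurability.
transitivity (\int[leb]_y ((`|a|^-1)%:E * \int[leb]_u (EFin \o G) (u, y)))%E.
  apply: eq_integral => y _.
  have mGy : measurable_fun [set: R] (fun u => (EFin \o G) (u, y)).
    by rewrite /comp /G/=; measurability; apply: mhc; measurability.
  rewrite -(ge0_integral_affine (b * y) a0 mGy (fun u => G0 _)).
  apply: eq_integral => x _; rewrite /G/=; congr (EFin (expR (- _ ^+ 2) * _)).
  by field.
have a1 : 0 <= `|a|^-1 by rewrite invr_ge0.
have mIG := measurable_integral_snd leb (measurableT_comp mG (@measurable_swap _ _ _ _)) (fun z => G0 _).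
rewrite (ge0_integralZl_EFin leb measurableT _ mIG a1); last first.
  by move=> y _; apply: integral_ge0 => u _; exact: G0.
rewrite -(@fubini_tonelli _ _ _ _ R leb leb (EFin \o G) mG G0).
have mg : measurable_fun [set: R] (fun u => (expR (- (rho^-1 * u) ^+ 2) * h u)%:E).
  by measurability.
have g0 u : (0 <= (expR (- (rho^-1 * u) ^+ 2) * h u)%:E)%E.
  by rewrite lee_fin mulr_ge0 ?expR_ge0.
transitivity (`|a|^-1%:E * \int[leb]_u ((`|a| / rho * K)%:E *
    (expR (- (rho^-1 * u) ^+ 2) * h u)%:E))%E.
  congr (_ * _)%E; apply: eq_integral => u _.
  have -> : ((`|a| / rho * K)%:E =
      \int[leb]_y (expR (- ((rho / a) * y - b * u / (rho * a)) ^+ 2))%:E)%E.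
    rewrite integral_gauss_affine ?mulf_neq0 ?invr_eq0//.
    by rewrite normrM normfV (gtr0_norm rho0) invfM invrK [rho^-1 * _]mulrC.
  have mgy : measurable_fun [set: R]
      (fun y => (expR (- ((rho / a) * y - b * u / (rho * a)) ^+ 2))%:E).
    by measurability.
  have k0 : 0 <= expR (- (rho^-1 * u) ^+ 2) * h u by rewrite mulr_ge0 ?expR_ge0.
  rewrite muleC -(ge0_integralZl_EFin leb measurableT _ mgy k0); last first.
    by move=> y _; rewrite lee_fin expR_ge0.
  apply: eq_integral => y _; rewrite -EFinM /G/=; congr EFin.
  rewrite [LHS]mulrA [RHS]mulrAC -!expRD; congr (expR _ * _); rewrite -!opprD; congr (- _).
  (* completing the square: both sides, times [rho ^+ 2 * a ^+ 2], equal
     [(b * u - rho ^+ 2 * y) ^+ 2 + a ^+ 2 * u ^+ 2] *)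
  apply: (@mulfI _ (rho ^+ 2 * a ^+ 2)); first by rewrite mulf_neq0 ?expf_neq0.
  transitivity (rho ^+ 2 * ((u - b * y) ^+ 2 + a ^+ 2 * y ^+ 2)).
    by field; rewrite a0.
  transitivity ((b * u - rho ^+ 2 * y) ^+ 2 + a ^+ 2 * u ^+ 2).
    by rewrite rho2; ring.
  by field; rewrite a0.
rewrite (ge0_integralZl_EFin leb measurableT (fun u _ => g0 u) mg); last first.
  by rewrite mulr_ge0 ?sqrtr_ge0 ?divr_ge0 ?normr_ge0 ?(ltW rho0).
have mgr : measurable_fun [set: R] (fun t => (expR (- t ^+ 2) * h (rho * t))%:E).
  by measurability; apply: mhc; measurability.
transitivity (K%:E * (rho^-1%:E * \int[leb]_u (expR (- (rho^-1 * u) ^+ 2) * h u)%:E))%E.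
  rewrite !muleA -!EFinM; congr (_%:E * _)%E.
  by rewrite !mulrA mulVf ?normr_eq0// mul1r mulrC.
congr (_ * _)%E.
rewrite -{1}(gtr0_norm rho0) -(ge0_integral_affine 0 rhon0 mg g0).
by apply: eq_integral => t _; rewrite addr0 mulrA mulVf// mul1r.
Qed.

End gaussian.

Section projection.
Context {R : realType}.
Notation leb := (@lebesgue_measure R).
Notation K := (Num.sqrt pi : R).

(** The Gaussian measure looks the same along every direction: coordinates are
    absorbed one by one with [gauss_rotation], the linear form [dot a] being
    replaced by a multiple of a single coordinate. *)
Lemma gauss_projection n (a : Rn R n) (h : R -> R) :
  measurable_fun setT h -> (forall t, 0 <= h t) ->
  (K%:E * \int[lebesgue_Rn R n]_x (expR (- norm2 x ^+ 2) * h (dot a x))%:E =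
   (K ^+ n)%:E * \int[leb]_t (expR (- t ^+ 2) * h (norm2 a * t))%:E)%E.
Proof.
elim: n a h => [|n IHn] a h mh h0.
  rewrite ge0_integral_Rn0 expr0 mul1e.
  have -> : @norm2 R 0 [tuple] = 0 by rewrite /norm2 big_ord0 sqrtr0.
  have -> : norm2 a = 0 by rewrite /norm2 big_ord0 sqrtr0.
  rewrite /dot big_ord0 expr0n oppr0 expR0 mul1r.
  under [RHS]eq_integral do rewrite mul0r EFinM.
  rewrite ge0_integralZr//; last 2 first.
  - by measurability.
  - by rewrite lee_fin.
  by rewrite integralT_gauss.
have [[a0 a'] /= ->] : exists z : R * Rn R n, a = [tuple of z.1 :: z.2].
  by exists (thead a, [tuple of behead a]) => /=; rewrite -tuple_eta.
have mhc d (T : measurableType d) (f : T -> R) : measurable_fun setT f ->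
    measurable_fun setT (fun z => h (f z)).
  by move=> mf; exact (measurableT_comp mh mf).
have mf : measurable_fun [set: Rn R n.+1] (fun x => (expR (- norm2 x ^+ 2) *
    h (dot [tuple of a0 :: a'] x))%:E).
  by measurability; apply: mhc; measurability.
have f0 x : (0 <= (expR (- norm2 x ^+ 2) * h (dot [tuple of a0 :: a'] x))%:E)%E.
  by rewrite lee_fin mulr_ge0 ?expR_ge0.
rewrite (ge0_integral_RnS mf f0).
have Knn : 0 <= K ^+ n by rewrite exprn_ge0 ?sqrtr_ge0.
pose F (z : R * R) := expR (- z.1 ^+ 2) * (expR (- z.2 ^+ 2) * h (a0 * z.1 + norm2 a' * z.2)).
have F0 z : (0 <= (F z)%:E)%E by rewrite lee_fin !mulr_ge0 ?expR_ge0.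
have mF : measurable_fun setT (EFin \o F).
  by rewrite /comp /F; measurability; apply: mhc; measurability.
have mIf := measurable_integral_snd (lebesgue_Rn R n)
  (measurableT_comp mf (@measurable_consRn R n)) (fun z => f0 _).
rewrite -(ge0_integralZl_EFin leb measurableT _ mIf (sqrtr_ge0 _)); last first.
  by move=> x _; apply: integral_ge0 => t _; exact: f0.
transitivity (\int[leb]_x ((K ^+ n)%:E * \int[leb]_t (EFin \o F) (x, t)))%E.
  apply: eq_integral => x _.
  have mg : measurable_fun [set: Rn R n] (fun t => (expR (- norm2 t ^+ 2) *
     h (a0 * x + dot a' t))%:E).
    by measurability; apply: mhc; measurability.
  have g0 t : (0 <= (expR (- norm2 t ^+ 2) * h (a0 * x + dot a' t))%:E)%E.
    by rewrite lee_fin mulr_ge0 ?expR_ge0.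
  transitivity ((expR (- x ^+ 2))%:E * (K%:E * \int[lebesgue_Rn R n]_t
     (expR (- norm2 t ^+ 2) * h (a0 * x + dot a' t))%:E))%E.
    rewrite muleCA; congr (_ * _)%E.
    rewrite -(ge0_integralZl_EFin _ measurableT (fun t _ => g0 t) mg (expR_ge0 _)).
    apply: eq_integral => t _.
    by rewrite /= /consRn/= norm2_cons dot_cons opprD expRD -EFinM mulrA.
  rewrite (IHn a' (fun s => h (a0 * x + s)))//; last first.
    by refine (mhc _ _ (fun s => a0 * x + s) _); measurability.
  rewrite muleCA; congr (_ * _)%E.
  have mg' : measurable_fun [set: R] (fun t => (expR (- t ^+ 2) *
     h (a0 * x + norm2 a' * t))%:E).
    by measurability; apply: mhc; measurability.
  rewrite -(ge0_integralZl_EFin leb measurableT _ mg' (expR_ge0 _)) => [//|t _].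
  by rewrite lee_fin mulr_ge0 ?expR_ge0.
have mIF := measurable_integral_snd leb mF F0.
rewrite (ge0_integralZl_EFin leb measurableT _ mIF Knn); last first.
  by move=> x _; apply: integral_ge0 => t _; exact: F0.
rewrite gauss_rotation ?norm2_ge0// muleA -EFinM -exprSr; congr (_ * _)%E.
apply: eq_integral => t _; congr (EFin (_ * h (_ * _))).
by rewrite -norm2_cons sqrtr_sqr ger0_norm ?norm2_ge0.
Qed.

End projection.

(** * Averaging over dilations *)

Section mellin.
Context {R : realType}.
Notation leb := (@lebesgue_measure R).

Lemma ereal_divl (k y : R) (X : \bar R) : 0 < k ->
  (k%:E * X = y%:E)%E -> X = (y / k)%:E.
Proof.
move=> k0; case: X => [r||].
- by rewrite -EFinM => -[<-]; rewrite mulrAC divff ?gt_eqF// mul1r.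
- by rewrite mulry gtr0_sg// mul1e.
- by rewrite mulrNy gtr0_sg// mul1e.
Qed.

(** A substitute for polar coordinates.  Insert
    [Gamma (p / 2) = norm2 x `^ p * integral of t `^ (p / 2 - 1) * expR (- (t * norm2 x ^+ 2))],
    exchange the integrals, and rescale by [w = t `^ 2^-1 *: x].  The function
    [f] is then only seen through its integrals [g] along rays, weighted by a
    Gaussian. *)
Lemma mellin n (p : R) (f g : Rn R n -> R) : 0 < p ->
  measurable_fun setT f -> (forall x, 0 <= f x) ->
  (forall x, norm2 x = 0 -> f x = 0) ->
  (forall w, 0 < norm2 w ->
    (\int[leb]_t ((0 < t)%R%:R *
       (t `^ (- (n%:R / 2) - 1) * f (scaleRn (t `^ (- 2^-1)) w)))%:E = (g w)%:E)%E) ->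
  ((Gamma (p / 2))%:E * \int[lebesgue_Rn R n]_x (f x)%:E =
   \int[lebesgue_Rn R n]_w (expR (- norm2 w ^+ 2) * (norm2 w `^ p * g w))%:E)%E.
Proof.
move=> p0 mf f0 fz fg; have p20 : 0 < p / 2 by rewrite divr_gt0.
have mfc d (T : measurableType d) (u : T -> Rn R n) : measurable_fun setT u ->
    measurable_fun setT (fun z => f (u z)).
  by move=> mu; exact (measurableT_comp mf mu).
have mfE : measurable_fun [set: Rn R n] (fun x => (f x)%:E) by measurability.
rewrite -(ge0_integralZl_EFin _ measurableT _ mfE (ltW (Gamma_gt0 p20))); last first.
  by move=> x _; rewrite lee_fin.
pose F (z : Rn R n * R) := (0 < z.2)%R%:R * (z.2 `^ (p / 2 - 1) *
  (f z.1 * (norm2 z.1 `^ p * expR (- (norm2 z.1 ^+ 2 * z.2))))).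
have F0 z : (0 <= (F z)%:E)%E.
  by rewrite lee_fin !mulr_ge0 ?powR_ge0 ?expR_ge0.
have mF : measurable_fun setT (EFin \o F).
  by rewrite /comp /F; measurability; apply: mfc; measurability.
transitivity (\int[lebesgue_Rn R n]_x \int[leb]_t (EFin \o F) (x, t))%E.
  apply: eq_integral => x _.
  have [x0|x0] := eqVneq (norm2 x) 0.
    rewrite (fz _ x0) mule0; apply/esym/integral0_eq => t _.
    by rewrite /F/= fz// mul0r !mulr0.
  have nx : 0 < norm2 x by rewrite lt_def x0 norm2_ge0.
  have nx2 : 0 < norm2 x ^+ 2 by rewrite exprn_gt0.
  have mh : measurable_fun [set: R] (fun t => ((0 < t)%R%:R *
     (t `^ (p / 2 - 1) * expR (- (norm2 x ^+ 2 * t))))%:E) by measurability.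
  have k0 : 0 <= f x * norm2 x `^ p by rewrite mulr_ge0 ?powR_ge0.
  transitivity ((f x * norm2 x `^ p)%:E * \int[leb]_t ((0 < t)%R%:R *
     (t `^ (p / 2 - 1) * expR (- (norm2 x ^+ 2 * t))))%:E)%E.
    rewrite (integral_gamma_scale (p / 2) nx2) gammaK// muleA -!EFinM.
    rewrite -(powR_mulrn 2 (ltW nx)) -powRrM mulrN mulrCA divff// mulr1 powRN.
    by rewrite mulfK ?gt_eqF ?powR_gt0// mulrC.
  rewrite -(ge0_integralZl_EFin leb measurableT _ mh k0); last first.
    by move=> t _; rewrite lee_fin !mulr_ge0 ?powR_ge0 ?expR_ge0.
  by apply: eq_integral => t _; rewrite /F/= -EFinM; congr EFin; ring.
rewrite (@fubini_tonelli _ _ _ _ R (lebesgue_Rn R n) leb (EFin \o F) mF F0).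
pose G (z : Rn R n * R) := (0 < z.2)%R%:R * (z.2 `^ (- (n%:R / 2) - 1) *
  (f (scaleRn (z.2 `^ (- 2^-1)) z.1) * (norm2 z.1 `^ p * expR (- norm2 z.1 ^+ 2)))).
have G0 z : (0 <= (G z)%:E)%E.
  by rewrite lee_fin !mulr_ge0 ?powR_ge0 ?expR_ge0.
have mG : measurable_fun setT (EFin \o G).
  by rewrite /comp /G; measurability; apply: mfc; measurability.
transitivity (\int[leb]_t \int[lebesgue_Rn R n]_x (EFin \o G) (x, t))%E.
  apply: eq_integral => t _.
  have [t0|t0] := leP t 0.
    rewrite !integral0_eq// => x _; rewrite ?/F ?/G/= ltNge t0/= mul0r//.
  pose c := t `^ 2^-1; have c0 : 0 < c by rewrite powR_gt0.
  have c2 : c ^+ 2 = t.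
    by rewrite -powR_mulrn ?ltW// -powRrM mulVf// powRr1// ltW.
  have mGt : measurable_fun [set: Rn R n] (fun x => (EFin \o G) (x, t)).
    by rewrite /comp /G/=; measurability; apply: mfc; measurability.
  have cK (X : \bar R) : ((c `^ n%:R)%:E * ((c `^ (- n%:R))%:E * X) = X)%E.
    by rewrite muleA -EFinM -gt0_powRD// subrr powRr0 mul1e.
  rewrite -[RHS]cK -(ge0_integral_Rn_scale c0 mGt (fun x => G0 _)).
  rewrite -(ge0_integralZl_EFin _ measurableT _ _ (powR_ge0 _ _)); last 2 first.
  - by move=> x _; exact: G0.
  - refine (@measurableT_comp _ _ _ _ _ _ _ setT (scaleRn c) mGt _).
    by measurability.
  apply: eq_integral => x _; rewrite -EFinM /F /G/= t0 !mul1r; congr EFin.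
  rewrite scaleRnA norm2_scale gtr0_norm// powRN mulVf ?gt_eqF// scale1Rn.
  rewrite exprMn c2 powRM ?norm2_ge0 ?ltW// [t * _]mulrC.
  have -> : t `^ (p / 2 - 1) = c `^ n%:R * (t `^ (- (n%:R / 2) - 1) * c `^ p).
    by rewrite /c -!powRrM -!gt0_powRD//; congr (_ `^ _); field.
  ring.
rewrite -(@fubini_tonelli _ _ _ _ R (lebesgue_Rn R n) leb (EFin \o G) mG G0).
apply: eq_integral => w _.
have [w0|w0] := eqVneq (norm2 w) 0.
  rewrite w0 powR0 ?gt_eqF// mul0r mulr0; apply: integral0_eq => t _.
  by rewrite /G/= w0 powR0 ?gt_eqF// mul0r !mulr0.
have nw : 0 < norm2 w by rewrite lt_def w0 norm2_ge0.
rewrite mulrA EFinM -(fg w nw) -ge0_integralZl_EFin//; last 3 first.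
- by move=> t _; rewrite lee_fin !mulr_ge0 ?powR_ge0 ?expR_ge0.
- by measurability; apply: mfc; measurability.
- by rewrite mulr_ge0 ?powR_ge0 ?expR_ge0.
by apply: eq_integral => t _; rewrite /G/= -EFinM; congr EFin; ring.
Qed.

End mellin.

(** * Moments of the Gaussian and of the ball *)

Section riesz.
Context {R : realType}.
Notation leb := (@lebesgue_measure R).
Notation K := (Num.sqrt pi : R).

Lemma integral_gauss_Rn n :
  (\int[lebesgue_Rn R n]_x (expR (- norm2 x ^+ 2))%:E = (K ^+ n)%:E)%E.
Proof.
have K0 := @gauss_const_gt0 R.
have := @gauss_projection R n [tuple 0 | i < n] (fun=> 1) (measurable_cst _)
  (fun=> ler01).
under eq_integral do rewrite mulr1.
under [in RHS]eq_integral do rewrite mulr1.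
rewrite integralT_gauss -EFinM => /(ereal_divl K0) ->.
by rewrite mulfK ?gt_eqF.
Qed.

Lemma powRN_half_lt (t c : R) : 0 < t -> 0 <= c ->
  (t `^ (- 2^-1) * c < 1) = (c ^+ 2 < t).
Proof.
move=> t0 c0; rewrite powRN mulrC ltr_pdivrMr ?powR_gt0// mul1r powR12_sqrt ?ltW//.
by rewrite -[in RHS](sqr_sqrtr (ltW t0)) ltr_pXn2r ?nnegrE ?sqrtr_ge0.
Qed.

(** [mellin] in dimension one, for the indicator function of the interval from
    [0] to [1], whose integral is [1]. *)
Lemma integral_pos_powR_gauss (s : R) : 0 < s + 1 ->
  (\int[leb]_t (expR (- t ^+ 2) * ((0 < t)%R%:R * t `^ s))%:E =
   (Gamma ((s + 1) / 2) / 2)%:E)%E.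
Proof.
move=> s0.
have hdE (x : Rn R 1) : norm2 x = `|thead x|.
  by rewrite /norm2 big_ord1 sqrtr_sqr.
have mhd : measurable_fun [set: Rn R 1] (fun x => thead x) by exact: measurable_tnth.
pose f (x : Rn R 1) : R := ((0 < thead x) && (thead x < 1))%:R.
have mf : measurable_fun setT f.
  rewrite /f; measurability; exact: mhd.
have f0 x : 0 <= f x by [].
have fz x : norm2 x = 0 -> f x = 0.
  by rewrite hdE /f => /eqP; rewrite normr_eq0 => /eqP ->; rewrite ltxx.
pose g (w : Rn R 1) : R := (0 < thead w)%R%:R * (2 * thead w `^ (- 1)).
have := @mellin R 1 (s + 1) f g s0 mf f0 fz.
have -> : (\int[lebesgue_Rn R 1]_x (f x)%:E = 1)%E.
  rewrite ge0_integral_RnS//; last by measurability.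
  under eq_integral do rewrite ge0_integral_Rn0.
  transitivity (\int[leb]_(x in `]0%R, 1%R[) (cst 1 x)%:E)%E.
    rewrite (integral_bool leb `]0%R, 1%R[%classic (b := fun t => (0 < t) && (t < 1))); last first.
      by move=> t; rewrite /= in_itv.
    by apply: eq_integral => x _; rewrite mulr1.
  rewrite -[LHS]/(\int[leb]_(x in `]0%R, 1%R[) cst 1%E x)%E integral_cst//=.
  by rewrite lebesgue_measure_itv/= lte_fin ltr01 oppr0 adde0 mule1.
rewrite mule1 => H; apply: (@ereal_divl _ 2) => //.
rewrite H => [|w]; last first.
  rewrite hdE normr_gt0 /g => w0.
  have fE t : 0 < t -> f (scaleRn (t `^ (- 2^-1)) w) =
      (0 < thead w)%R%:R * (thead w ^+ 2 < t)%R%:R.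
    move=> t0; rewrite /f /thead tnth_mktuple -/(thead w) pmulr_rgt0 ?powR_gt0//.
    by case: ltP => //= w1; rewrite ?mul0r// powRN_half_lt ?ltW// mul1r.
  have [wpos|wneg] := ltP 0 (thead w); last first.
    rewrite mul0r; apply: integral0_eq => t _.
    by case: ltP => t0; rewrite ?mul0r// fE// ltNge wneg/= !mul0r !mulr0.
  have w2 : 0 < thead w ^+ 2 by rewrite exprn_gt0.
  have h0 : 0 < 2^-1 :> R by rewrite invr_gt0.
  have [+ _] := @integral_powR_tail R _ _ h0 w2.
  have -> : (thead w ^+ 2) `^ (- 2^-1) / 2^-1 = 2 * thead w `^ (- 1).
    rewrite -powR_mulrn ?ltW// -powRrM mulrN divff//.
    by rewrite invrK mulrC.
  rewrite !mul1r => <-; apply: eq_integral => t _; congr EFin.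
  case: ltP => t0; last first.
    by rewrite mul0r ltNge (le_trans t0) ?sqr_ge0//= mul0r.
  by rewrite fE// wpos !mul1r mulrC.
rewrite ge0_integral_RnS.
- apply/esym; under eq_integral do rewrite ge0_integral_Rn0.
  rewrite -(ge0_integralZl_EFin leb measurableT); last 3 first.
  - by move=> t _; rewrite lee_fin !mulr_ge0 ?expR_ge0 ?powR_ge0.
  - by measurability.
  - by [].
  apply: eq_integral => t _; rewrite -EFinM; congr EFin.
  rewrite hdE theadE /g theadE real_normK ?num_real//.
  case: ltP => t0; last by rewrite !mul0r !mulr0.
  rewrite gtr0_norm// !mul1r.
  have -> : t `^ s = t `^ (s + 1) * t `^ (- 1) by rewrite -gt0_powRD// addrK.
  ring.
- by rewrite /g; measurability; exact: mhd.
- move=> x; rewrite lee_fin /g; have [w0|w0] := ltP 0 (thead x).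
    by rewrite !mulr_ge0 ?expR_ge0 ?powR_ge0.
  by rewrite mul0r !mulr0.
Qed.

(** The origin lies in a hyperplane, a null set. *)
Lemma integral_Rn_origin n (f : Rn R n -> R) : (0 < n)%N ->
  measurable_fun setT f -> (forall x, 0 <= f x) ->
  (\int[lebesgue_Rn R n]_x ((norm2 x <= 0)%R%:R * f x)%:E = 0)%E.
Proof.
case: n f => // n f _ mf f0.
have mfE : measurable_fun [set: Rn R n.+1] (fun x => ((norm2 x <= 0)%R%:R * f x)%:E).
  by measurability.
rewrite (ge0_integral_RnS mfE) => [|x]; last by rewrite lee_fin mulr_ge0.
set g := (fun x => \int[_]_t _)%E.
rewrite (_ : g = g \_ [set 0]).
  by rewrite -integral_mkcond integral_set1.
apply/funext => x; rewrite patchE; case: ifPn => //.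
rewrite notin_setE/= => x0; apply: integral0_eq => t _.
rewrite (_ : (norm2 _ <= 0) = false) ?mul0r//; apply/negbTE; rewrite -ltNge.
rewrite lt_def norm2_ge0 andbT; apply: contra_not_neq x0 => x0.
have := norm2_cons x t; rewrite x0 expr0n => /esym/eqP.
by rewrite paddr_eq0 ?sqr_ge0// sqrf_eq0 => /andP[/eqP].
Qed.

(** In [mellin] with [p = n] the ray integral of the integrand is a multiple of
    [norm2 w `^ (- n)], so the Gaussian integral has no weight left. *)
Lemma integral_ball_powR n (s : R) : (0 < n)%N -> 0 < s ->
  (\int[lebesgue_Rn R n]_x ((norm2 x < 1)%R%:R * norm2 x `^ s)%:E =
   (2 / (n%:R + s) * K ^+ n / Gamma (n%:R / 2))%:E)%E.
Proof.
move=> n0 s0; have nR0 : 0 < n%:R :> R by rewrite ltr0n.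
have ns0 : 0 < n%:R + s by rewrite addr_gt0.
have [k kE] : exists k : R, k = 2 / (n%:R + s) by eexists.
have c0 : 0 <= k by rewrite kE divr_ge0// ltW.
rewrite -kE.
apply: ereal_divl; first by rewrite Gamma_gt0// divr_gt0.
rewrite (@mellin R n n%:R _ (fun w => norm2 w `^ (- n%:R) * k))//.
- have mE : measurable_fun [set: Rn R n] (fun w => (expR (- norm2 w ^+ 2))%:E).
    by measurability.
  rewrite EFinM -integral_gauss_Rn.
  have e0 (w : Rn R n) : (0 <= (expR (- norm2 w ^+ 2))%:E)%E by rewrite lee_fin expR_ge0.
  rewrite -(ge0_integralZl_EFin _ measurableT (fun w _ => e0 w) mE c0).
  (* the weights cancel except at the origin, where they vanish *)
  transitivity (\int[lebesgue_Rn R n]_w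
    ((expR (- norm2 w ^+ 2) * (norm2 w `^ n%:R * (norm2 w `^ (- n%:R) * k)))%:E
     + ((norm2 w <= 0)%R%:R * (expR (- norm2 w ^+ 2) * k))%:E))%E.
    rewrite ge0_integralD//; try solve [measurability]; try solve
      [move=> w _; by rewrite lee_fin !mulr_ge0 ?expR_ge0 ?powR_ge0].
    rewrite (integral_Rn_origin (f := fun w => expR (- norm2 w ^+ 2) * k))//.
    - by rewrite adde0.
    - by measurability.
    - by move=> w; rewrite mulr_ge0 ?expR_ge0.
  apply: eq_integral => w _; rewrite -EFinD -EFinM; congr EFin.
  have [w0|w0] := leP (norm2 w) 0.
    have -> : norm2 w = 0 by apply/eqP; rewrite eq_le w0 norm2_ge0.
    by rewrite powR0 ?gt_eqF// mul0r mulr0 add0r mul1r mulrC.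
  have -> : norm2 w `^ n%:R * (norm2 w `^ (- n%:R) * k) = k.
    by rewrite mulrA -gt0_powRD// subrr powRr0 mul1r.
  by rewrite mul0r addr0 mulrC.
- by measurability.
- by move=> x; rewrite mulr_ge0 ?powR_ge0.
- by move=> x ->; rewrite powR0 ?gt_eqF// mulr0.
move=> w w0.
have w2 : 0 < norm2 w ^+ 2 by rewrite exprn_gt0.
have ns2 : 0 < (n%:R + s) / 2 by rewrite divr_gt0.
have [+ _] := @integral_powR_tail R _ _ ns2 w2.
move/(congr1 (fun u => (norm2 w `^ s)%:E * u)%E).
rewrite -(ge0_integralZl_EFin leb measurableT _ _ (powR_ge0 _ _)); last 2 first.
- by move=> t _; rewrite lee_fin mulr_ge0 ?powR_ge0.
- by measurability.
have -> : ((norm2 w `^ s)%:E *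
    ((norm2 w ^+ 2) `^ (- ((n%:R + s) / 2)) / ((n%:R + s) / 2))%:E =
    (norm2 w `^ (- n%:R) * k)%:E)%E.
  rewrite -EFinM mulrA -powR_mulrn ?ltW// -powRrM -gt0_powRD// invf_div kE.
  by rewrite (_ : s + _ = - n%:R); last by field.
move=> <-; apply: eq_integral => t _; rewrite -EFinM; congr EFin.
have [t0|t0] := ltP 0 t; last first.
  by rewrite mul0r ltNge (le_trans t0) ?sqr_ge0//= mul0r mulr0.
rewrite mul1r norm2_scale gtr0_norm ?powR_gt0// powRN_half_lt ?ltW//.
rewrite powRM ?powR_ge0 ?norm2_ge0// -powRrM.
rewrite [t `^ (- ((n%:R + s) / 2) - 1)](_ : _ = t `^ (- (n%:R / 2) - 1) * t `^ (- 2^-1 * s)).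
  by ring.
by rewrite -gt0_powRD//; congr (_ `^ _); field.
Qed.

End riesz.

(** * Riesz energy of the ball *)

Section riesz_energy.
Context {R : realType}.
Notation leb := (@lebesgue_measure R).
Notation K := (Num.sqrt pi : R).

Lemma sqr_powR (u v : R) : 0 <= u -> (u ^+ 2) `^ v = u `^ (2 * v).
Proof. by move=> u0; rewrite -powR_mulrn// -powRrM. Qed.

Section potential.
Variables (n : nat) (sigma : R).
Hypotheses (sigma0 : sigma != 0) (s0 : 0 < n%:R + sigma).
Let s := n%:R + sigma.

(** On the ray of [w] the region [norm2 z ^+ 2 < 2 * dot x z] is a bounded
    interval issued from the origin if [0 < dot x w], and empty otherwise.  The
    flag [C] selects the strict or the large inequality. *)
Lemma mellin_half_space (C : bool) (x w : Rn R n) : 0 < norm2 w ->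
  (\int[leb]_t ((0 < t)%R%:R * (t `^ (- (n%:R / 2) - 1) *
     ((norm2 (scaleRn (t `^ (- 2^-1)) w) ^+ 2 <
        2 * dot x (scaleRn (t `^ (- 2^-1)) w) ?<= if C)%R%:R *
      norm2 (scaleRn (t `^ (- 2^-1)) w) `^ sigma)))%:E =
   (norm2 w `^ (- (sigma + 2 * n%:R)) *
     ((0 < dot x w)%R%:R * (2 / s * 2 `^ s * dot x w `^ s)))%:E)%E.
Proof.
move=> w0; set D := dot x w.
have ub t : 0 < t -> 0 < t `^ (- 2^-1) by move=> t0; rewrite powR_gt0.
have [D0|D0] := ltP 0 D; last first.
  rewrite mul0r mulr0; apply: integral0_eq => t _.
  have [t0|t0] := ltP 0 (t : R); last by rewrite mul0r.
  rewrite (_ : Order.lteif _ _ _ = false) ?mul0r ?mulr0//.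
  have : 2 * dot x (scaleRn (t `^ (- 2^-1)) w) < norm2 (scaleRn (t `^ (- 2^-1)) w) ^+ 2.
    rewrite (@le_lt_trans _ _ 0)//.
      by rewrite dot_scale -/D pmulr_rle0// pmulr_rle0 ?ub.
    by rewrite exprn_gt0// norm2_scale mulr_gt0// normr_gt0 gt_eqF ?ub.
  by case: (C) => /= h; apply/negbTE; rewrite ?ltNge ?negbK -?ltNge// ltW.
(* [t `^ (- 2^-1) *: w] lies in the region when [c < t `^ 2^-1] *)
pose c := norm2 w ^+ 2 / (2 * D).
have c0 : 0 < c by rewrite divr_gt0 ?exprn_gt0// mulr_gt0.
have c2 : 0 < c ^+ 2 by rewrite exprn_gt0.
have s2 : 0 < s / 2 by rewrite divr_gt0.
have tail : (\int[leb]_t ((c ^+ 2 < t ?<= if C)%R%:R * t `^ (- (s / 2) - 1))%:E =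
    ((c ^+ 2) `^ (- (s / 2)) / (s / 2))%:E)%E.
  by have [h1 h2] := @integral_powR_tail R _ _ s2 c2; case: C.
rewrite mul1r.
have -> : (norm2 w `^ (- (sigma + 2 * n%:R)) * (2 / s * 2 `^ s * D `^ s))%:E =
    ((norm2 w `^ sigma)%:E * ((c ^+ 2) `^ (- (s / 2)) / (s / 2))%:E)%E.
  rewrite -EFinM; congr EFin.
  rewrite [(c ^+ 2) `^ _]sqr_powR ?ltW// (_ : 2 * - (s / 2) = - s); last by field.
  have -> : c = norm2 w ^+ 2 * (2 * D) `^ (- 1) by rewrite powR_inv1 ?mulr_ge0// ltW.
  rewrite powRM ?sqr_ge0 ?powR_ge0// -powRrM mulN1r opprK sqr_powR ?ltW//.
  rewrite powRM ?ltW// invf_div.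
  rewrite (_ : - (sigma + 2 * n%:R) = sigma + 2 * - s); last by rewrite /s; ring.
  by rewrite gt0_powRD//; ring.
rewrite -tail -(ge0_integralZl_EFin leb measurableT); last 3 first.
- by move=> t _; rewrite lee_fin mulr_ge0 ?powR_ge0.
- by measurability.
- exact: powR_ge0.
apply: eq_integral => t _; rewrite -EFinM; congr EFin.
case: ltP => t0; last first.
  rewrite mul0r (_ : Order.lteif _ _ _ = false) ?mul0r ?mulr0//.
  by case: (C) => /=; apply/negbTE; rewrite -?leNgt -?ltNge ?(le_lt_trans t0) ?(le_trans t0)// ltW.
rewrite mul1r norm2_scale dot_scale gtr0_norm ?ub// -/D.
have -> : ((t `^ (- 2^-1) * norm2 w) ^+ 2 < 2 * (t `^ (- 2^-1) * D) ?<= if C) =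
    (c ^+ 2 < t ?<= if C).
  set u := t `^ (- 2^-1); have u0 : 0 < u by exact: ub.
  have ut : u^-1 ^+ 2 = t.
    by rewrite /u powRN invrK powR12_sqrt ?sqr_sqrtr// ltW.
  rewrite -[in RHS]ut exprMn expr2 -mulrA [2 * (u * D)]mulrCA.
  have D20 : 0 < 2 * D by rewrite mulr_gt0.
  have cu : (u * norm2 w ^+ 2 < 2 * D ?<= if C) = (c < u^-1 ?<= if C).
    rewrite /c; case: (C) => /=.
      by rewrite ler_pdivrMr// [u^-1 * _]mulrC ler_pdivlMr// mulrC.
    by rewrite ltr_pdivrMr// [u^-1 * _]mulrC ltr_pdivlMr// mulrC.
  have u1 : u^-1 \is Num.nneg by rewrite nnegrE invr_ge0 ltW.
  have c1 : c \is Num.nneg by rewrite nnegrE ltW.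
  case: (C) cu => /= cu; first by rewrite ler_pM2l// cu ler_sqr.
  by rewrite ltr_pM2l// cu ltr_sqr.
rewrite powRM ?powR_ge0 ?norm2_ge0// -powRrM.
rewrite [t `^ (- (s / 2) - 1)](_ : _ = t `^ (- (n%:R / 2) - 1) * t `^ (- 2^-1 * sigma)).
  by ring.
by rewrite -gt0_powRD//; congr (_ `^ _); rewrite /s; field.
Qed.

Definition potential_const : R :=
  2 / s * 2 `^ s * (K ^+ n * (Gamma ((s + 1) / 2) / 2) / K) /
    Gamma ((sigma + 2 * n%:R) / 2).

Lemma potential_const_gt0 : (0 < n)%N -> 0 < potential_const.
Proof.
move=> n0; have nR0 : 0 < n%:R :> R by rewrite ltr0n.
have K0 := @gauss_const_gt0 R.
have p0 : 0 < sigma + 2 * n%:R.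
  by rewrite mulr_natl mulr2n addrA addr_gt0// addrC.
have s1 : 0 < s + 1 by rewrite addr_gt0.
rewrite /potential_const divr_gt0 ?Gamma_gt0 ?divr_gt0//.
rewrite mulr_gt0 ?divr_gt0 ?mulr_gt0 ?exprn_gt0 ?powR_gt0 ?invr_gt0//.
by rewrite ?divr_gt0 ?Gamma_gt0 ?divr_gt0.
Qed.

Lemma integral_pos_dot (x : Rn R n) :
  (\int[lebesgue_Rn R n]_w (expR (- norm2 w ^+ 2) *
      ((0 < dot x w)%R%:R * dot x w `^ s))%:E =
   (K ^+ n * (Gamma ((s + 1) / 2) / 2) / K * norm2 x `^ s)%:E)%E.
Proof.
pose h (t : R) := (0 < t)%R%:R * t `^ s.
have h0 t : 0 <= h t by rewrite mulr_ge0 ?powR_ge0.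
have mh : measurable_fun [set: R] h by rewrite /h; measurability.
rewrite (@ereal_divl _ K (K ^+ n * (Gamma ((s + 1) / 2) / 2) * norm2 x `^ s)
   (\int[lebesgue_Rn R n]_w (expR (- norm2 w ^+ 2) * h (dot x w))%:E)%E).
- by congr EFin; rewrite mulrAC.
- exact: gauss_const_gt0.
rewrite (gauss_projection x mh h0).
have hx t : h (norm2 x * t) = norm2 x `^ s * h t.
  rewrite /h; have [x0|x0] := eqVneq (norm2 x) 0.
    by rewrite x0 mul0r ltxx mul0r powR0 ?gt_eqF// mul0r.
  have nx : 0 < norm2 x by rewrite lt_def x0 norm2_ge0.
  rewrite pmulr_rgt0//; case: ltP => t0; last by rewrite !mul0r mulr0.
  by rewrite !mul1r powRM// ltW.
have mg : measurable_fun [set: R] (fun t => (expR (- t ^+ 2) * h t)%:E).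
  by rewrite /h; measurability.
have g0 t : (0 <= (expR (- t ^+ 2) * h t)%:E)%E by rewrite lee_fin mulr_ge0 ?expR_ge0.
transitivity ((K ^+ n)%:E * ((norm2 x `^ s)%:E *
    \int[leb]_t (expR (- t ^+ 2) * h t)%:E))%E.
  congr (_ * _)%E.
  rewrite -(ge0_integralZl_EFin leb measurableT (fun t _ => g0 t) mg (powR_ge0 _ _)).
  by apply: eq_integral => t _; rewrite hx -EFinM mulrCA.
have s1 : 0 < s + 1 by rewrite addr_gt0.
rewrite (integral_pos_powR_gauss s1) -!EFinM; congr EFin; ring.
Qed.

(** Homogeneity predicts the power of [norm2 x]; [mellin] with
    [p = sigma + 2 * n] cancels the power of [norm2 w] in [mellin_half_space]
    and so yields the constant. *)
Lemma integral_potential (C : bool) (x : Rn R n) :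
  (\int[lebesgue_Rn R n]_y ((norm2 y < norm2 x ?<= if C)%R%:R * dist2 x y `^ sigma)%:E =
   (potential_const * norm2 x `^ s)%:E)%E.
Proof.
have p0 : 0 < sigma + 2 * n%:R by rewrite mulr_natl mulr2n addrA addrC ltr_wpDl// addrC.
pose f (z : Rn R n) : R := (norm2 z ^+ 2 < 2 * dot x z ?<= if C)%R%:R * norm2 z `^ sigma.
have mf : measurable_fun setT f by rewrite /f; measurability.
have f0 z : 0 <= f z by rewrite mulr_ge0 ?powR_ge0.
transitivity (\int[lebesgue_Rn R n]_z (f z)%:E)%E.
  (* [y = x - z] turns [norm2 y < norm2 x] into [norm2 z ^+ 2 < 2 * dot x z] *)
  pose F (y : Rn R n) := ((norm2 y < norm2 x ?<= if C)%R%:R * dist2 x y `^ sigma)%:E.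
  have mF : measurable_fun setT F by rewrite /F; measurability.
  have F0 y : (0 <= F y)%E by rewrite lee_fin mulr_ge0 ?powR_ge0.
  have N10 : -1 != 0 :> R by rewrite oppr_eq0 oner_eq0.
  have := ge0_integral_Rn_affine x N10 mF F0.
  rewrite normrN1 expr1n invr1 mul1e => <-; apply: eq_integral => z _.
  rewrite /F /f dist2_sub; congr (EFin ((nat_of_bool _)%:R * _)).
  have E u v : 0 <= u -> 0 <= v ->
      (u < v ?<= if C) = (u ^+ 2 < v ^+ 2 ?<= if C).
    by move=> u0 v0; case: (C) => /=; rewrite ?ler_sqr ?ltr_sqr.
  rewrite E ?norm2_ge0// norm2_sub.
  by case: (C) => /=; apply/idP/idP => ?; lra.
have -> : potential_const * norm2 x `^ s = 2 / s * 2 `^ s *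
   (K ^+ n * (Gamma ((s + 1) / 2) / 2) / K * norm2 x `^ s) /
   Gamma ((sigma + 2 * n%:R) / 2) by rewrite /potential_const; ring.
apply: ereal_divl; first by rewrite Gamma_gt0// divr_gt0.
have [k kE] : exists k : R, k = 2 / s * 2 `^ s by eexists.
have k0 : 0 <= k by rewrite kE !mulr_ge0 ?powR_ge0// invr_ge0 ltW.
rewrite -kE EFinM -integral_pos_dot.
rewrite (mellin p0 mf f0 _ (fun w w0 => mellin_half_space C x w0)); last first.
  by move=> z z0; rewrite /f z0 powR0// mulr0.
have mE : measurable_fun [set: Rn R n] (fun w => (expR (- norm2 w ^+ 2) *
    ((0 < dot x w)%R%:R * dot x w `^ s))%:E) by measurability.
have E0 (w : Rn R n) : (0 <= (expR (- norm2 w ^+ 2) *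
    ((0 < dot x w)%R%:R * dot x w `^ s))%:E)%E.
  by rewrite lee_fin !mulr_ge0 ?expR_ge0 ?powR_ge0.
rewrite -(ge0_integralZl_EFin _ measurableT (fun w _ => E0 w) mE k0).
apply: eq_integral => w _; rewrite -EFinM -kE; congr EFin.
have [w0|w0] := eqVneq (norm2 w) 0.
  rewrite (norm2_eq0 w0) dot_scale mul0r ltxx norm2_scale normr0 mul0r.
  by rewrite powR0 ?gt_eqF// !mul0r !mulr0.
have nw : 0 < norm2 w by rewrite lt_def w0 norm2_ge0.
by rewrite !mulrA -[_ * _ * norm2 w `^ (- _)]mulrA -gt0_powRD// subrr powRr0; ring.
Qed.

End potential.

Definition riesz_energy_ball n (sigma : R) : R :=
  2 * potential_const n sigma *
  (2 / (n%:R + (n%:R + sigma)) * K ^+ n / Gamma (n%:R / 2)).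

(** The unit ball is described by the larger of [norm2 x] and [norm2 y] alone, so
    each of the two parts of its square reduces to [integral_potential]
    followed by [integral_ball_powR]. *)
Lemma calJ_ball n (sigma : R) : (0 < n)%N -> sigma != 0 -> 0 < n%:R + sigma ->
  calJ sigma (@unit_ball R n) = riesz_energy_ball n sigma.
Proof.
move=> n0 sigma0 s0; have [Cv CvE] : exists Cv : R, Cv = potential_const n sigma by eexists.
have Cv0 : 0 <= Cv by rewrite CvE ltW// potential_const_gt0.
rewrite /calJ /riesz_energy_ball -CvE.
pose F1 (z : Rn R n * Rn R n) := (norm2 z.1 < 1)%R%:R *
  ((norm2 z.2 < norm2 z.1)%R%:R * dist2 z.1 z.2 `^ sigma).
pose F2 (z : Rn R n * Rn R n) := (norm2 z.2 < 1)%R%:R *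
  ((norm2 z.1 <= norm2 z.2)%R%:R * dist2 z.2 z.1 `^ sigma).
have F10 z : (0 <= (F1 z)%:E)%E by rewrite lee_fin !mulr_ge0 ?powR_ge0.
have F20 z : (0 <= (F2 z)%:E)%E by rewrite lee_fin !mulr_ge0 ?powR_ge0.
have mF1 : measurable_fun setT (EFin \o F1) by rewrite /comp /F1; measurability.
have mF2 : measurable_fun setT (EFin \o F2) by rewrite /comp /F2; measurability.
have N C (I : Rn R n -> \bar R) :
    (forall x, I x = \int[lebesgue_Rn R n]_y
      ((norm2 x < 1)%R%:R * ((norm2 y < norm2 x ?<= if C)%R%:R * dist2 x y `^ sigma))%:E)%E ->
    (\int[lebesgue_Rn R n]_x I x =
      (Cv * (2 / (n%:R + (n%:R + sigma)) * K ^+ n / Gamma (n%:R / 2)))%:E)%E.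
  move=> IE.
  have mb : measurable_fun [set: Rn R n] (fun x => ((norm2 x < 1)%R%:R *
     norm2 x `^ (n%:R + sigma))%:E) by measurability.
  have b0 (x : Rn R n) : (0 <= ((norm2 x < 1)%R%:R * norm2 x `^ (n%:R + sigma))%:E)%E.
    by rewrite lee_fin mulr_ge0 ?powR_ge0.
  rewrite EFinM -integral_ball_powR//.
  rewrite -(ge0_integralZl_EFin _ measurableT (fun x _ => b0 x) mb Cv0).
  apply: eq_integral => x _; rewrite IE.
  have mc : measurable_fun [set: Rn R n] (fun y =>
      ((norm2 y < norm2 x ?<= if C)%R%:R * dist2 x y `^ sigma)%:E) by measurability.
  have c0 (y : Rn R n) : (0 <= ((norm2 y < norm2 x ?<= if C)%R%:R * dist2 x y `^ sigma)%:E)%E.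
    by rewrite lee_fin mulr_ge0 ?powR_ge0.
  under eq_integral do rewrite EFinM.
  rewrite (ge0_integralZl_EFin _ measurableT (fun y _ => c0 y) mc (ler0n _ _)).
  by rewrite integral_potential// -!EFinM -CvE; congr EFin; ring.
have m1 := measurable_integral_snd (lebesgue_Rn R n) mF1 F10.
have m2 := measurable_integral_snd (lebesgue_Rn R n) mF2 F20.
rewrite (_ : (\int[_]_(x in _) _)%E =
  (\int[lebesgue_Rn R n]_x (\int[lebesgue_Rn R n]_y (EFin \o F1) (x, y) +
                            \int[lebesgue_Rn R n]_y (EFin \o F2) (x, y)))%E).
  have i1 x : setT x -> (0 <= \int[lebesgue_Rn R n]_y (EFin \o F1) (x, y))%E.
    by move=> _; apply: integral_ge0 => y _; exact: F10.
  have i2 x : setT x -> (0 <= \int[lebesgue_Rn R n]_y (EFin \o F2) (x, y))%E.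
    by move=> _; apply: integral_ge0 => y _; exact: F20.
  rewrite (ge0_integralD _ measurableT i1 m1 i2 m2).
  have e1 : (\int[lebesgue_Rn R n]_x \int[lebesgue_Rn R n]_y (EFin \o F1) (x, y) =
      (Cv * (2 / (n%:R + (n%:R + sigma)) * K ^+ n / Gamma (n%:R / 2)))%:E)%E.
    apply: (N false) => x; apply: eq_integral => y _.
    by rewrite /F1 /=.
  have e2 : (\int[lebesgue_Rn R n]_y \int[lebesgue_Rn R n]_x (EFin \o F2) (x, y) =
      (Cv * (2 / (n%:R + (n%:R + sigma)) * K ^+ n / Gamma (n%:R / 2)))%:E)%E.
    apply: (N true) => x; apply: eq_integral => y _.
    by rewrite /F2 /=.
  have e2' := etrans (@fubini_tonelli _ _ _ _ R (lebesgue_Rn R n) (lebesgue_Rn R n)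
    (EFin \o F2) mF2 F20) e2.
  transitivity (fine ((Cv * (2 / (n%:R + (n%:R + sigma)) * K ^+ n / Gamma (n%:R / 2)))%:E +
    (Cv * (2 / (n%:R + (n%:R + sigma)) * K ^+ n / Gamma (n%:R / 2)))%:E)%E).
    by congr (fine (_ + _)%E); [exact e1|exact e2'].
  by rewrite -EFinD /=; ring.
rewrite integral_mkcond; apply: eq_integral => x _; rewrite patchE.
have mF1x : measurable_fun [set: Rn R n] (fun y => (EFin \o F1) (x, y)).
  by rewrite /F1/=; measurability.
have mF2x : measurable_fun [set: Rn R n] (fun y => (EFin \o F2) (x, y)).
  by rewrite /F2/=; measurability.
rewrite -(ge0_integralD _ measurableT (fun y _ => F10 _) mF1x (fun y _ => F20 _) mF2x).
case: ifPn => xB.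
  rewrite (integral_bool _ _ (b := fun y => norm2 y < 1))//.
  apply: eq_integral => y _; rewrite -EFinD; congr EFin; rewrite /F1 /F2/=.
  have x1 : norm2 x < 1 by move: xB; rewrite inE.
  rewrite x1 [dist2 y x]dist2C; case: (leP (norm2 x) (norm2 y)) => [xy|yx].
    by rewrite !mul0r mulr0 add0r mul1r.
  by rewrite (lt_trans yx x1) !mul0r mulr0 addr0 !mul1r.
have x1 : norm2 x < 1 = false by apply/negbTE; move: xB; rewrite notin_setE/= => /negP.
apply/esym/integral0_eq => y _; rewrite -EFinD /F1 /F2/= x1 mul0r add0r.
case: (leP (norm2 x) (norm2 y)) => [xy|yx]; last by rewrite mul0r mulr0.
rewrite (_ : norm2 y < 1 = false) ?mul0r//; apply/negbTE; rewrite -leNgt.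
by apply: le_trans xy; rewrite leNgt x1.
Qed.

Lemma riesz_energy_ball_gt0 n (sigma : R) : (0 < n)%N -> 0 < n%:R + sigma ->
  0 < riesz_energy_ball n sigma.
Proof.
move=> n0 s0; have nR0 : 0 < n%:R :> R by rewrite ltr0n.
rewrite /riesz_energy_ball; apply: mulr_gt0.
  by rewrite mulr_gt0 ?potential_const_gt0.
apply: divr_gt0; last by rewrite Gamma_gt0// divr_gt0.
by rewrite mulr_gt0 ?exprn_gt0 ?gauss_const_gt0// divr_gt0// addr_gt0.
Qed.

(** The measure of the ball dominates its first moment and, as
    [exp (- norm2 x ^+ 2) >= exp (- 1)] there, is dominated by a Gaussian. *)
Lemma omega_gt0 n : (0 < n)%N -> 0 < omega n :> R.
Proof.
move=> n0; have nR0 : 0 < n%:R :> R by rewrite ltr0n.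
have mB : measurable_fun [set: Rn R n] (fun x => ((norm2 x < 1)%R%:R : R)%:E).
  by measurability.
have BE : (lebesgue_Rn R n (@unit_ball R n) =
    \int[lebesgue_Rn R n]_x ((norm2 x < 1)%R%:R : R)%:E)%E.
  have mball : measurable (@unit_ball R n).
    rewrite (_ : @unit_ball R n = (fun x => norm2 x < 1) @^-1` [set true]).
      rewrite -[X in measurable X]setTI.
      have mlt : measurable_fun [set: Rn R n] (fun x => norm2 x < 1) by measurability.
      exact: mlt.
    by apply/seteqP; split => x.
  rewrite -[LHS]mul1e -(integral_cst _ mball 1).
  rewrite (integral_bool _ _ (b := fun x => norm2 x < 1) (f := fun=> 1))//.
  by apply: eq_integral => x _; rewrite mulr1.
have lo : (0 < lebesgue_Rn R n (@unit_ball R n))%E.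
  have : (0%:E < (2 / (n%:R + 1) * K ^+ n / Gamma (n%:R / 2))%:E)%E.
    rewrite lte_fin; apply: divr_gt0; last by rewrite Gamma_gt0// divr_gt0.
    by rewrite mulr_gt0 ?exprn_gt0 ?gauss_const_gt0// divr_gt0// addr_gt0.
  rewrite -integral_ball_powR// BE => /lt_le_trans; apply.
  apply: ge0_le_integral => //.
  - by move=> x _; rewrite lee_fin mulr_ge0 ?powR_ge0.
  - by measurability.
  - move=> x _; rewrite lee_fin; case: ltP => x1; last by rewrite mul0r ler0n.
    by rewrite mul1r powRr1 ?norm2_ge0// ltW.
have hi : (lebesgue_Rn R n (@unit_ball R n) < +oo)%E.
  have mg : measurable_fun [set: Rn R n] (fun x => (expR (- norm2 x ^+ 2))%:E).
    by measurability.
  have g0 (x : Rn R n) : (0 <= (expR (- norm2 x ^+ 2))%:E)%E by rewrite lee_fin expR_ge0.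
  have : ((expR 1)%:E * (K ^+ n)%:E < +oo)%E by rewrite -EFinM ltry.
  rewrite -integral_gauss_Rn.
  rewrite -(ge0_integralZl_EFin _ measurableT (fun x _ => g0 x) mg (expR_ge0 _)).
  apply: le_lt_trans; rewrite BE; apply: ge0_le_integral => //.
  - by apply: emeasurable_funM => //; exact: measurable_cst.
  - move=> x _; rewrite -EFinM lee_fin -expRD; case: ltP => x1; last exact: expR_ge0.
    apply: (@le_trans _ _ (expR 0)); first by rewrite expR0.
    by rewrite ler_expR subr_ge0 exprn_ile1 ?norm2_ge0// ltW.
by rewrite /omega fine_gt0// lo.
Qed.

End riesz_energy.

(** * The products defining the spectrum *)

(** The quotient of the two sides of the hypothesis is the product of
    [(x - y) / (x + y + D)], [(2 * y + D + 1) / (2 * y + D - 1)] and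
    [(y + D - a) / (y + a)], all of which decrease in [y]. *)
Lemma cross_ineq_succ (R : realFieldType) (D a x y : R) :
  2 <= D -> 0 <= a -> 0 < D - 1 - 2 * a -> 1 <= y -> y + 1 < x ->
  (x - y) * (2 * (y + 1) + D - 1) * (y + D - a) <=
    (2 * y + D - 1) * (x + y + D) * (y + a) ->
  (x - (y + 1)) * (2 * (y + 2) + D - 1) * (y + 1 + D - a) <=
    (2 * (y + 1) + D - 1) * (x + (y + 1) + D) * (y + 1 + a).
Proof.
move=> D2 a0 aD y1 yx h.
have h1 : (x - y - 1) * (x + y + D) <= (x - y) * (x + y + 1 + D).
  rewrite -subr_ge0 [leRHS](_ : _ = 2 * x + D); [lra|ring].
have h2 : (2 * (y + 2) + D - 1) * (2 * y + D - 1) <=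
    (2 * y + D + 1) * (2 * (y + 1) + D - 1).
  rewrite -subr_ge0 [leRHS](_ : _ = 4); [lra|ring].
have h3 : (y + 1 + D - a) * (y + a) <= (y + D - a) * (y + 1 + a).
  rewrite -subr_ge0 [leRHS](_ : _ = D - 2 * a); [lra|ring].
have p : 0 < (2 * y + D - 1) * (x + y + D) * (y + a).
  by rewrite !mulr_gt0//; lra.
rewrite -(ler_pM2r p).
apply: (@le_trans _ _ (((x - y) * (x + y + 1 + D)) *
    ((2 * y + D + 1) * (2 * (y + 1) + D - 1)) * ((y + D - a) * (y + 1 + a)))).
  rewrite [leLHS](_ : _ = ((x - y - 1) * (x + y + D)) *
    ((2 * (y + 2) + D - 1) * (2 * y + D - 1)) * ((y + 1 + D - a) * (y + a))); last ring.
  have q1 : 0 <= (x - y - 1) * (x + y + D) by apply: mulr_ge0; lra.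
  have q2 : 0 <= (2 * (y + 2) + D - 1) * (2 * y + D - 1) by apply: mulr_ge0; lra.
  have q3 : 0 <= (y + 1 + D - a) * (y + a) by apply: mulr_ge0; lra.
  exact: (ler_pM (mulr_ge0 q1 q2) q3 (ler_pM q1 q2 h1 h2) h3).
rewrite [leLHS](_ : _ = ((2 * (y + 1) + D - 1) * (x + (y + 1) + D) * (y + 1 + a)) *
   ((x - y) * (2 * (y + 1) + D - 1) * (y + D - a))); last ring.
rewrite ler_wpM2l//; apply: mulr_ge0; last lra.
by apply: mulr_ge0; lra.
Qed.

(** Multiplied by [D - 1 - 2 * a], the difference of the two sides is a positive
    multiple of the slack in the threshold plus a positive term. *)
Lemma cross_ineq_at1 (R : realFieldType) (D a x : R) :
  2 <= D -> 0 <= a -> 0 < D - 1 - 2 * a ->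
  3 * D + 1 + a * (D - 1) <= (D - 1 - 2 * a) * x ->
  (D + 1) * (x + 1 + D) * (1 + a) <= (x - 1) * (D + 3) * (1 + D - a).
Proof.
move=> D2 a0 aD xs; rewrite -subr_ge0 -(pmulr_rge0 _ aD).
rewrite [leRHS](_ : _ = (D + 2) * (D + 1 - 2 * a) *
  ((D - 1 - 2 * a) * x - (3 * D + 1 + a * (D - 1))) +
  (D + 1) * (D + 3) * (D + 2)); last ring.
by rewrite addr_ge0// !mulr_ge0//; lra.
Qed.

Section spectral_products.
Context {R : realType}.
Variables (D a x : R).

Definition attr_prod (k : nat) : R :=
  \prod_(1 <= j < k) ((j%:R + a) / (j%:R + D - 1 - a)).

(** The factors are taken in absolute value, since [j - x] changes sign; the
    signed product only matters through this bound and at [k = 3]. *)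
Definition rep_prod (k : nat) : R :=
  \prod_(1 <= j < k) (`|j%:R - x| / (j%:R + D - 1 + x)).

Hypotheses (D2 : 2 <= D) (a0 : 0 <= a) (aD : 0 < D - 1 - 2 * a).
Hypothesis (xstar : 3 * D + 1 + a * (D - 1) <= (D - 1 - 2 * a) * x).

Local Ltac alra := move: D2 a0 aD => ? ? ?; lra.
Local Ltac plra := move: D2 a0 aD xstar => ? ? ? ?; lra.

Local Notation P := rep_prod.
Local Notation Q := attr_prod.

Lemma attr_prodS k : (0 < k)%N -> Q k.+1 = Q k * ((k%:R + a) / (k%:R + D - 1 - a)).
Proof. by move=> k0; rewrite /attr_prod big_nat_recr. Qed.

Lemma rep_prodS k : (0 < k)%N -> P k.+1 = P k * (`|k%:R - x| / (k%:R + D - 1 + x)).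
Proof. by move=> k0; rewrite /rep_prod big_nat_recr. Qed.

Lemma attr_prod1 : Q 1 = 1. Proof. by rewrite /attr_prod big_geq. Qed.
Lemma rep_prod1 : P 1 = 1. Proof. by rewrite /rep_prod big_geq. Qed.

Lemma threshold_gt3 : 3 < x.
Proof.
rewrite ltNge; apply/negP => x3.
have : 0 <= (D - 1 - 2 * a) * (3 - x) by apply: mulr_ge0; plra.
have : 0 <= a * (D - 1) by apply: mulr_ge0; plra.
plra.
Qed.

Let x3 := threshold_gt3.
Local Ltac qlra := move: x3 => ?; plra.

Let n1 k : (0 < k)%N -> 1 <= k%:R :> R. Proof. by move=> k0; rewrite ler1n. Qed.

Lemma attr_prod_gt0 k : (0 < k)%N -> 0 < Q k.
Proof.
elim: k => // -[_ _|k IHk _]; first by rewrite attr_prod1.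
rewrite attr_prodS// mulr_gt0 ?IHk//; have k1 := n1 (ltn0Sn k).
by rewrite divr_gt0//; alra.
Qed.

Lemma rep_prod_ge0 k : 0 <= P k.
Proof.
rewrite /rep_prod; apply: prodr_ge0 => j _.
by rewrite divr_ge0//; have := @ler0n R j; qlra.
Qed.

Lemma attr_prod_sub k : (0 < k)%N ->
  Q k - Q k.+1 = Q k * (D - 1 - 2 * a) / (k%:R + D - 1 - a).
Proof.
move=> k0; rewrite attr_prodS//; field.
have k1 := n1 k0; rewrite gt_eqF//; alra.
Qed.

Lemma rep_prod_sub k : (0 < k)%N ->
  P k - P k.+1 = P k * (2 * Num.min k%:R x + D - 1) / (k%:R + D - 1 + x).
Proof.
move=> k0; rewrite rep_prodS//.
have k1 := n1 k0; have kDx : k%:R + D - 1 + x != 0 by rewrite gt_eqF//; qlra.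
case: (leP k%:R x) => kx.
  by rewrite ler0_norm ?subr_le0//; field.
by rewrite gtr0_norm ?subr_gt0//; field.
Qed.

Lemma attr_prod_le1 k : (0 < k)%N -> Q k <= 1.
Proof.
elim: k => // -[_ _|k IHk _]; first by rewrite attr_prod1.
apply: le_trans (IHk isT); rewrite -subr_ge0 attr_prod_sub// divr_ge0//.
  by rewrite mulr_ge0 ?ltW ?attr_prod_gt0//.
have k1 := n1 (ltn0Sn k); alra.
Qed.

(** The factor at [k] is at most [(k + D + x - 2) / (k + D + x - 1)], so the
    product telescopes; in particular it tends to [0]. *)
Lemma rep_prod_le k : (0 < k)%N -> P k * (k%:R + D + x - 2) <= D + x - 1.
Proof.
elim: k => // -[_ _|k IHk _]; first by rewrite rep_prod1; qlra.
apply: le_trans (IHk isT); rewrite rep_prodS// -mulrA ler_wpM2l ?rep_prod_ge0//.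
have k1 := n1 (ltn0Sn k).
have kDx : 0 < k.+1%:R + D - 1 + x by qlra.
have E : k.+2%:R + D + x - 2 = k.+1%:R + D - 1 + x by rewrite -[k.+2%:R]natr1; ring.
rewrite E mulfVK ?gt_eqF//; rewrite ler_norml; apply/andP; split; qlra.
Qed.

Lemma rep_prod_lt1 k : (1 < k)%N -> P k < 1.
Proof.
move=> k1; have k0 := ltnW k1.
have kR : 2 <= k%:R :> R by rewrite (ler_nat _ 2).
have kDx : 0 < k%:R + D + x - 2 by qlra.
have := rep_prod_le k0; rewrite -ler_pdivlMr// => /le_lt_trans; apply.
by rewrite ltr_pdivrMr//; qlra.
Qed.

(* [V] is the ratio of the decrements of [P] and [Q]; [falls k] is
   [V k.+1 <= V k] with the denominators cleared. *)
Let V k := (P k - P k.+1) / (Q k - Q k.+1).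
Let falls k := `|k%:R - x| * (2 * Num.min k.+1%:R x + D - 1) * (k%:R + D - a) <=
  (2 * Num.min k%:R x + D - 1) * (x + k%:R + D) * (k%:R + a).

Let dQ_gt0 k : (0 < k)%N -> 0 < Q k - Q k.+1.
Proof.
move=> k0; have k1 := n1 k0; rewrite attr_prod_sub//; apply: divr_gt0; last alra.
by apply: mulr_gt0; [exact: attr_prod_gt0|].
Qed.

Let V_step k : (0 < k)%N -> exists2 c, 0 <= c & V k - V k.+1 = c *
  ((2 * Num.min k%:R x + D - 1) * (x + k%:R + D) * (k%:R + a) -
   `|k%:R - x| * (2 * Num.min k.+1%:R x + D - 1) * (k%:R + D - a)).
Proof.
move=> k0; have k1 := n1 k0.
exists (P k / Q k * (k%:R + D - 1 - a) / ((k%:R + D - 1 + x) * (D - 1 - 2 * a) * (k%:R + a) * (k%:R + D + x))).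
  have Qk := attr_prod_gt0 k0; have Pk := rep_prod_ge0 k.
  apply: divr_ge0; first by rewrite mulr_ge0 ?divr_ge0 ?(ltW Qk)//; qlra.
  rewrite !mulr_ge0//; qlra.
rewrite /V !rep_prod_sub// !attr_prod_sub// rep_prodS// attr_prodS// -[k.+1%:R]natr1.
have e1 : Q k != 0 by rewrite gt_eqF ?attr_prod_gt0.
field.
by rewrite e1 /=; do ! (apply/andP; split); rewrite gt_eqF//; qlra.
Qed.

Let V_falls k : (0 < k)%N -> falls k -> V k.+1 <= V k.
Proof.
move=> k0 fk; have [c c0 E] := V_step k0.
by rewrite -subr_ge0 E mulr_ge0// subr_ge0.
Qed.

Let V_rises k : (0 < k)%N -> ~~ falls k -> V k <= V k.+1.
Proof.
move=> k0; rewrite -ltNge => fk; have [c c0 E] := V_step k0.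
by rewrite -subr_le0 E mulr_ge0_le0// subr_le0 ltW.
Qed.

Let falls_past k : (0 < k)%N -> x <= k%:R -> falls k.
Proof.
move=> k0 xk; have k1 := n1 k0.
have xk1 : x <= k.+1%:R by rewrite -natr1; qlra.
rewrite /falls (min_idPr xk) (min_idPr xk1) ger0_norm ?subr_ge0//.
rewrite [_ * (2 * x + D - 1)]mulrC -!mulrA ler_wpM2l//; first by qlra.
rewrite [leRHS]mulrC ler_pM//; qlra.
Qed.

(* [V] is unimodal: once it falls it keeps falling. *)
Let fallsS k : (0 < k)%N -> falls k -> falls k.+1.
Proof.
move=> k0 fk; have k1 := n1 k0.
have [xk|kx] := leP x k.+1%:R; first exact: falls_past.
have kS : k.+1%:R = k%:R + 1 :> R by rewrite natr1.
have kSS : k.+2%:R = k%:R + 2 :> R by rewrite -(natrD _ k 2) addn2.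
have kx' : k%:R < x by apply: lt_trans kx; rewrite kS ltrDl.
move: fk; rewrite /falls (min_idPl (ltW kx')) (min_idPl (ltW kx)).
rewrite !ltr0_norm ?subr_lt0// !opprB kS kSS => fk.
have kx2 : k%:R + 1 < x by rewrite -kS.
apply: le_trans (cross_ineq_succ D2 a0 aD k1 kx2 fk).
rewrite ler_wpM2r ?ler_wpM2l//; try qlra.
have mle : Num.min (k%:R + 2) x <= k%:R + 2 by rewrite ge_min lexx.
by lra.
Qed.

(* The threshold makes the first step of [V] go up. *)
Let V12 : V 1 <= V 2.
Proof.
have [c c0 E] := V_step (ltn0Sn 0).
have x1 : 1 <= x by qlra.
have x2 : 2 <= x by qlra.
rewrite -subr_le0 E mulr_ge0_le0// (min_idPl x1) (min_idPl x2).
rewrite ltr0_norm; last by qlra.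
by rewrite subr_le0; have := cross_ineq_at1 D2 a0 aD xstar; lra.
Qed.

Lemma one_sub_rep_prod3 :
  1 - P 3 = (D + 2) * (D - 1 + 2 * x) / ((D + x) * (D + 1 + x)).
Proof.
rewrite rep_prodS// rep_prodS// rep_prod1 !ltr0_norm; [|qlra|qlra].
field; apply/andP; split; rewrite gt_eqF//; qlra.
Qed.

Lemma one_sub_attr_prod3 :
  1 - Q 3 = (D + 2) * (D - 1 - 2 * a) / ((D - a) * (D + 1 - a)).
Proof.
rewrite attr_prodS// attr_prodS// attr_prod1.
field; apply/andP; split; rewrite gt_eqF//; alra.
Qed.

(** The difference of the two sides is a positive multiple of the slack in the
    threshold, which is thus sharp here. *)
Lemma attr_prod3_le_rep_prod3 : Q 3 <= P 3.
Proof.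
rewrite -(lerD2l (-1)) -lerN2 !opprD !opprK one_sub_rep_prod3 one_sub_attr_prod3.
rewrite ler_pdivrMr; last by rewrite mulr_gt0; qlra.
rewrite mulrAC ler_pdivlMr; last by rewrite mulr_gt0; qlra.
rewrite -subr_ge0 (_ : _ - _ = (D + 2) * (x + a) *
   ((D - 1 - 2 * a) * x - (3 * D + 1 + a * (D - 1)))); last by ring.
by rewrite !mulr_ge0 ?subr_ge0//; qlra.
Qed.

(** Let [gap k] be the difference of the two sides and [kap] the average of [V]
    at [1] and [2], weighted by the decrements of [Q].  Then [gap] grows at [k]
    exactly when [V k < kap].  Suppose [gap k > 0]; since [gap 3 = 0], some
    [V j] lies below [kap], hence below [V 2], so by unimodality [V] falls from
    [j] on and [gap] never decreases again.  But [P] tends to [0], so the limit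
    of [gap] is at most [Q 3 - P 3 <= 0]. *)
Lemma spectral_ratio k : (2 < k)%N ->
  (1 - Q k) * (1 - P 3) <= (1 - P k) * (1 - Q 3).
Proof.
move=> k2; rewrite leNgt; apply/negP.
pose gap k := (1 - Q k) * (1 - P 3) - (1 - P k) * (1 - Q 3).
move=> Hk; have gk : 0 < gap k by rewrite subr_gt0.
have gap3 : gap 3 = 0 by rewrite /gap mulrC subrr.
have Q3 : 0 < 1 - Q 3 by rewrite one_sub_attr_prod3 divr_gt0 ?mulr_gt0//; qlra.
pose kap := (1 - P 3) / (1 - Q 3).
have gapS j : (0 < j)%N -> gap j.+1 - gap j = (kap - V j) * ((Q j - Q j.+1) * (1 - Q 3)).
  move=> j0; have := dQ_gt0 j0 => d0; rewrite /gap /kap /V; field.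
  by rewrite !gt_eqF.
have kap2 : kap <= V 2.
  rewrite /kap ler_pdivrMr//.
  have v2 : P 2 - P 3 = V 2 * (Q 2 - Q 3) by rewrite /V divfK// gt_eqF ?dQ_gt0.
  have v1 : P 1 - P 2 = V 1 * (Q 1 - Q 2) by rewrite /V divfK// gt_eqF ?dQ_gt0.
  have -> : 1 - P 3 = V 1 * (Q 1 - Q 2) + V 2 * (Q 2 - Q 3).
    by rewrite -v1 -v2 rep_prod1; ring.
  have -> : V 2 * (1 - Q 3) = V 2 * (Q 1 - Q 2) + V 2 * (Q 2 - Q 3).
    by rewrite attr_prod1; ring.
  by rewrite lerD2r ler_wpM2r// ltW// dQ_gt0.
(* [gap] cannot become positive without increasing somewhere *)
have [j /andP[j3 jk] gj] : exists2 j, (3 <= j < k)%N & gap j < gap j.+1.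
  have [/existsP[j /andP[j3 gj]]|/existsPn nj] :=
    boolP [exists j : 'I_k, (3 <= j)%N && (gap j < gap j.+1)].
    by exists j => //; rewrite j3 ltn_ord.
  suff H m : (3 <= m <= k)%N -> gap m <= gap 3.
    by have := H k; rewrite k2 leqnn gap3 leNgt gk => /(_ isT).
  elim: m => // m IHm /andP[m3 mk].
  move: m3; rewrite leq_eqVlt => /orP[/eqP <-//|m3].
  apply: le_trans (IHm _); last by rewrite -ltnS m3 ltnW.
  by have := nj (Ordinal mk); rewrite /= -ltnS m3 /= -leNgt.
have Vj : V j < kap.
  have j0 : (0 < j)%N by apply: leq_trans j3.
  move: gj; rewrite -subr_gt0 gapS// pmulr_lgt0 ?subr_gt0//.
  by rewrite mulr_gt0// dQ_gt0.
(* [V] must have fallen before [j], as [V j < kap <= V 2] *)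
have [i /andP[i2 ij] fi] : exists2 i, (2 <= i < j)%N & falls i.
  have [/existsP[i /andP[i2 fi]]|/existsPn ni] :=
    boolP [exists i : 'I_j, (2 <= i)%N && falls i].
    by exists i => //; rewrite i2 ltn_ord.
  suff H m : (2 <= m <= j)%N -> V 2 <= V m.
    have := le_trans kap2 (H j _); rewrite leNgt Vj (ltnW j3) leqnn.
    by move=> /(_ isT).
  elim: m => // m IHm /andP[m2 mj].
  move: m2; rewrite leq_eqVlt => /orP[/eqP <-//|m2].
  have m2' : (2 <= m)%N by rewrite -ltnS.
  apply: le_trans (IHm _) _; first by rewrite m2' ltnW.
  apply: V_rises; first by apply: leq_trans m2'.
  by have := ni (Ordinal mj); rewrite /= m2'.
have fm m : (i <= m)%N -> falls m.
  elim: m => [|m IHm]; first by rewrite leqn0 => /eqP i0; move: i2; rewrite i0.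
  rewrite leq_eqVlt ltnS => /orP[/eqP <-//|im]; apply: fallsS; last exact: IHm.
  by apply: leq_trans im; apply: leq_trans i2.
have Vm m : (j <= m)%N -> V m <= V j.
  elim: m => [|m IHm]; first by rewrite leqn0 => /eqP ->.
  rewrite leq_eqVlt ltnS => /orP[/eqP <-//|jm]; apply: le_trans (IHm jm).
  apply: V_falls; first by apply: leq_trans jm; apply: leq_trans j3.
  by apply: fm; apply: leq_trans jm; apply: ltnW.
have gm m : (k <= m)%N -> gap k <= gap m.
  elim: m => [|m IHm]; first by rewrite leqn0 => /eqP ->.
  rewrite leq_eqVlt ltnS => /orP[/eqP <-//|km]; apply: le_trans (IHm km) _.
  have m0 : (0 < m)%N by apply: leq_trans km; apply: leq_trans k2.
  rewrite -subr_ge0 gapS// mulr_ge0 ?mulr_ge0 ?(ltW Q3) ?(ltW (dQ_gt0 m0))//.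
  by rewrite subr_ge0 ltW// (le_lt_trans (Vm m _))// (leq_trans (ltnW jk)).
(* [P] tends to [0], so far enough it is below the positive [gap k] *)
have [m mk] : exists2 m, (k <= m)%N & P m < gap k.
  pose N := Num.truncn ((D + x - 1) / gap k).
  exists (k + N.+1)%N; first exact: leq_addr.
  have km : (0 < k + N.+1)%N by rewrite addnS.
  have Nb : (D + x - 1) / gap k < (k + N.+1)%:R.
    by apply: lt_le_trans (truncnS_gt _) _; rewrite ler_nat leq_addl.
  have m1 := n1 km.
  have d0 : 0 < (k + N.+1)%:R + D + x - 2 by qlra.
  have := rep_prod_le km; rewrite -ler_pdivlMr// => /le_lt_trans; apply.
  rewrite ltr_pdivrMr// mulrC -ltr_pdivrMr//; apply: lt_le_trans Nb _; qlra.
apply/negP; rewrite -leNgt; apply: le_trans (gm m mk) _.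
have m0 : (0 < m)%N by apply: leq_trans mk; apply: leq_trans k2.
have P31 := rep_prod_lt1 (isT : 1 < 3)%N.
apply: (@le_trans _ _ ((1 - P 3) - (1 - P m) * (1 - Q 3))).
  rewrite lerD2r ler_piMl//; first by rewrite subr_ge0 ltW.
  by rewrite gerBl ltW// attr_prod_gt0.
have QP := attr_prod3_le_rep_prod3.
have : P m * (1 - Q 3) <= P m.
  by rewrite ler_piMr ?rep_prod_ge0// gerBl ltW// attr_prod_gt0.
lra.
Qed.

(** The decrements of [Q] decrease, so [1 - Q k <= (k - 1) * (1 - Q 3) / 2] for
    [k >= 3]; the other factor [k + D - 1] is at least [D + 2]. *)
Lemma attr_prod_average k : (2 < k)%N ->
  (1 - Q k) * (2 * (D + 2)) <= (1 - Q 3) * ((k%:R - 1) * (k%:R + D - 1)).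
Proof.
move=> k2; have k0 : (0 < k)%N by apply: ltnW (ltnW k2).
have kR : 3 <= k%:R :> R by rewrite (ler_nat _ 3).
have dec j : (0 < j)%N -> Q j.+1 - Q j.+2 <= Q j - Q j.+1.
  move=> j0; have j1 := n1 j0; rewrite !attr_prod_sub// -[j.+1%:R]natr1.
  have Qj := attr_prod_gt0 j0; have Qj1 := attr_prod_gt0 (ltn0Sn j).
  have QQ : Q j.+1 <= Q j.
    by rewrite -subr_ge0 ltW ?dQ_gt0.
  rewrite ler_pM ?mulr_ge0 ?invr_ge0 ?ler_wpM2r ?(ltW Qj1) ?(ltW aD)//; first by alra.
  by rewrite lef_pV2 ?posrE; alra.
have dec2 j : (2 <= j)%N -> Q j - Q j.+1 <= (1 - Q 3) / 2.
  elim: j => // j IHj; rewrite leq_eqVlt ltnS => /orP[/eqP <-|j2].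
    by have := dec 1%N isT; rewrite attr_prod1 ler_pdivlMr//; lra.
  by apply: le_trans (dec j _) (IHj j2); apply: leq_trans j2.
have linear_bound j : (3 <= j)%N -> 1 - Q j <= (1 - Q 3) / 2 * (j%:R - 1).
  elim: j => // j IHj; rewrite leq_eqVlt ltnS => /orP[/eqP <-|j3]; first lra.
  have := IHj j3; have := dec2 j (ltnW j3); rewrite -[j.+1%:R]natr1; lra.
have Q3 : 0 <= 1 - Q 3 by rewrite subr_ge0 attr_prod_le1.
apply: (@le_trans _ _ ((1 - Q 3) / 2 * (k%:R - 1) * (2 * (D + 2)))).
  by rewrite ler_wpM2r ?linear_bound//; alra.
rewrite [leLHS](_ : _ = (1 - Q 3) * ((k%:R - 1) * (D + 2))); last by field.
by rewrite !ler_wpM2l//; alra.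
Qed.

End spectral_products.

(** * Monotonicity of the curves *)

Section mode_curves.
Context {R : realType}.

(** With [t = expR y] this is the strict convexity of the exponential. *)
Lemma bernoulli_powR_lt (p t : R) : 1 < p -> 0 <= t -> t != 1 ->
  1 + p * (t - 1) < t `^ p.
Proof.
move=> p1; rewrite le_eqVlt => /orP[/eqP <- _|t0 t1].
  by rewrite powR0 ?gt_eqF//; lra.
have [y y0 tE] : exists2 y, y != 0 & t = expR y.
  by exists (ln t); [rewrite ln_eq0|rewrite lnK].
have tpE : t `^ p = expR (p * y) by rewrite /powR tE gt_eqF ?expR_gt0// expRK.
have yy : 0 < expR y by exact: expR_gt0.
(* tangent lines to the exponential, used at [(p - 1) * y] and at [- y] *)
have h1 : expR y * (1 + (p - 1) * y) < expR (p * y).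
  rewrite (_ : p * y = y + (p - 1) * y); last by ring.
  by rewrite expRD ltr_pM2l// expR_gt1Dx// mulf_neq0// subr_eq0 gt_eqF.
have h2 : expR y * (1 - y) < 1.
  rewrite [ltRHS](_ : _ = expR y * expR (- y)); last by rewrite -expRD subrr expR0.
  by rewrite ltr_pM2l// expR_gt1Dx// oppr_eq0.
have h3 : (p - 1) * (expR y * (1 - y)) < (p - 1) * 1.
  by rewrite ltr_pM2l// subr_gt0.
rewrite tpE tE; lra.
Qed.

Lemma powR_tangent_lt (p u v : R) : 1 < p -> 0 <= u -> 0 < v -> u != v ->
  v `^ p + p * v `^ (p - 1) * (u - v) < u `^ p.
Proof.
move=> p1 u0 v0 uv; have v1 := ltW v0.
have := @bernoulli_powR_lt p (u / v) p1 (divr_ge0 u0 (ltW v0)) _.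
have -> : u / v != 1 by rewrite -subr_eq0 -(divff (lt0r_neq0 v0)) -mulrBl mulf_neq0 ?subr_eq0 ?invr_eq0// gt_eqF.
move=> /(_ isT); rewrite -(ltr_pM2l (powR_gt0 p v0)) -powRM ?divr_ge0//.
have -> : v * (u / v) = u by field; rewrite gt_eqF.
apply: le_lt_trans.
have -> : v `^ p = v `^ (p - 1) * v.
  by rewrite -[X in _ = _ * X](powRr1 (ltW v0)) -gt0_powRD// subrK.
rewrite [leRHS](_ : _ = v `^ (p - 1) * v + p * v `^ (p - 1) * (u - v))//.
by field; rewrite gt_eqF.
Qed.

Let slope_up (k c m u u' p p' : R) : p + k * m * (u - u') < p' ->
  k * m * (u' - u) <= k * c * (u' - u) -> k * c * u - p' < k * c * u' - p.
Proof. lra. Qed.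

Let slope_down (k c m u u' p p' : R) : p + k * m * (u' - u) < p' ->
  k * c * (u' - u) <= k * m * (u' - u) -> k * c * u' - p' < k * c * u - p.
Proof. lra. Qed.

(** In the variable [u = m `^ r] this is [A * u - B * u `^ p] with
    [p = (r + q) / r > 1], a concave function whose derivative vanishes where
    [r * A = (r + q) * B * m `^ q]. *)
Definition mode_curve (r q A B m : R) : R := m `^ r * (A - B * m `^ q).

Variables (r q A B c : R).
Hypotheses (r0 : 0 < r) (q0 : 0 < q) (B0 : 0 < B).
Hypothesis (cE : r * A = (r + q) * B * c `^ q).

Let mode_curveE m : 0 <= m ->
  mode_curve r q A B m = B * ((r + q) / r * c `^ q * m `^ r - (m `^ r) `^ ((r + q) / r)).
Proof.
move=> m0; rewrite /mode_curve -powRrM (_ : r * ((r + q) / r) = r + q); last first.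
  by field; rewrite gt_eqF.
have rn0 : r != 0 by rewrite gt_eqF.
have -> : A = (r + q) / r * B * c `^ q by apply: (mulfI rn0); rewrite cE; field.
have -> : m `^ (r + q) = m `^ r * m `^ q.
  have := m0; rewrite le_eqVlt => /orP[/eqP <-|m1]; last exact: gt0_powRD.
  by rewrite !powR0 ?mulr0// gt_eqF// addr_gt0.
ring.
Qed.

Let p1 : 1 < (r + q) / r.
Proof. by rewrite ltr_pdivlMr// mul1r ltrDl. Qed.

Let powE m : (m `^ r) `^ ((r + q) / r - 1) = m `^ q.
Proof. by rewrite -powRrM; congr (_ `^ _); field; rewrite gt_eqF. Qed.

Lemma mode_curve_increasing m m' : 0 <= c -> 0 <= m -> m < m' -> m' <= c ->
  mode_curve r q A B m < mode_curve r q A B m'.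
Proof.
move=> c0 m0 mm' mc.
have m'0 : 0 < m' by apply: le_lt_trans mm'.
rewrite !mode_curveE ?(ltW m'0)// ltr_pM2l//.
have uu : m `^ r < m' `^ r by rewrite gt0_ltr_powR ?nnegrE ?(ltW m'0).
have := @powR_tangent_lt _ (m `^ r) (m' `^ r) p1 (powR_ge0 _ _) (powR_gt0 _ m'0)
  (negbT (lt_eqF uu)).
rewrite powE => h.
have qc : m' `^ q <= c `^ q by rewrite ge0_ler_powR ?nnegrE ?(ltW q0) ?(ltW m'0).
apply: slope_up h _; rewrite ler_wpM2r ?subr_ge0 ?(ltW uu)// ler_wpM2l//.
by rewrite ltW// (lt_trans ltr01).
Qed.

Lemma mode_curve_decreasing m m' : 0 < c -> c <= m -> m < m' ->
  mode_curve r q A B m' < mode_curve r q A B m.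
Proof.
move=> c0 cm mm'.
have m0 : 0 < m by apply: lt_le_trans cm.
have m'0 : 0 < m' by apply: lt_trans mm'.
rewrite !mode_curveE ?(ltW m'0) ?(ltW m0)// ltr_pM2l//.
have uu : m `^ r < m' `^ r by rewrite gt0_ltr_powR ?nnegrE ?(ltW m0) ?(ltW m'0).
have := @powR_tangent_lt _ (m' `^ r) (m `^ r) p1 (powR_ge0 _ _) (powR_gt0 _ m0)
  (negbT (gt_eqF uu)).
rewrite powE => h.
have qc : c `^ q <= m `^ q by rewrite ge0_ler_powR ?nnegrE ?(ltW q0) ?(ltW m0) ?(ltW c0).
apply: slope_down h _; rewrite ler_wpM2r ?subr_ge0 ?(ltW uu)// ler_wpM2l//.
by rewrite ltW// (lt_trans ltr01).
Qed.

End mode_curves.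

(** * The coefficients A and B *)

Section spectrum.
Context {R : realType}.
Variable d : nat.
Hypothesis d2 : (2 <= d)%N.
Notation D := (d%:R : R).

Definition mu_factor (sigma : R) : R :=
  (D - 1) * omega d.-1 * 2 `^ (D - 1 + sigma) *
  (Gamma ((D - 1 + sigma) / 2) * Gamma ((D - 1) / 2) / Gamma ((2 * D - 2 + sigma) / 2)).

(** The factor [j = 0] of the product in [mu] is split off, as it is common to
    all [k >= 1]. *)
Definition mu_prod (sigma : R) (k : nat) : R :=
  \prod_(1 <= j < k) ((j%:R - sigma / 2) / (j%:R + D - 1 + sigma / 2)).

Let D2 : 2 <= D. Proof. by rewrite (ler_nat _ 2). Qed.

Lemma mu_factor_gt0 (sigma : R) : 0 < D - 1 + sigma -> 0 < mu_factor sigma.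
Proof.
move=> s0; have hD := D2; have om : 0 < omega d.-1 :> R.
  by apply: omega_gt0; case: d d2 => [|[]].
rewrite /mu_factor !mulr_gt0 ?divr_gt0 ?invr_gt0 ?powR_gt0 ?Gamma_gt0 ?mulr_gt0//; lra.
Qed.

Lemma mu_sub_mu1 (sigma : R) k : (0 < k)%N ->
  mu d k sigma - mu d 1 sigma =
  - (mu_factor sigma * ((sigma / 2) / (D - 1 + sigma / 2)) * (1 - mu_prod sigma k)).
Proof.
move=> k0; rewrite /mu -/(mu_factor sigma) big_ord1.
rewrite -(big_mkord xpredT (fun j => (j%:R - sigma / 2) / (j%:R + D - 1 + sigma / 2))).
rewrite big_ltn//= -/(mu_prod sigma k).
have -> : (0 - sigma / 2) / (0 + D - 1 + sigma / 2) = - (sigma / 2 / (D - 1 + sigma / 2)).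
  by rewrite sub0r add0r mulNr.
ring.
Qed.

Lemma lambda_sub_lambda1 k :
  lambda d k - lambda d 1 = (k%:R - 1) * (k%:R + D - 1) :> R.
Proof. by rewrite /lambda; ring. Qed.

Variables alpha beta : R.
Hypotheses (al0 : 0 < alpha) (al1 : alpha < D - 1) (be0 : 0 < beta).
Hypothesis (best : beta_star d alpha <= beta).
Notation A := (A_ d alpha).
Notation B := (B_ d beta).

Definition attr_const := mu_factor (- alpha) * (alpha / 2 / (D - 1 - alpha / 2)).
Definition rep_const := mu_factor beta * (beta / 2 / (D - 1 + beta / 2)).

Lemma attr_const_gt0 : 0 < attr_const.
Proof.
have hD := D2; have h0 := al0; have h1 := al1.
apply: mulr_gt0; first by apply: mu_factor_gt0; lra.
by apply: divr_gt0; lra.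
Qed.

Lemma rep_const_gt0 : 0 < rep_const.
Proof.
have hD := D2; have h0 := be0.
apply: mulr_gt0; first by apply: mu_factor_gt0; lra.
by apply: divr_gt0; lra.
Qed.

Lemma A_E k : (0 < k)%N ->
  A k = attr_const * ((1 - attr_prod D (alpha / 2) k) / ((k%:R - 1) * (k%:R + D - 1))).
Proof.
move=> k0; rewrite /A_ lambda_sub_lambda1 mu_sub_mu1//.
rewrite [RHS]mulrA; congr (_ / _).
have -> : mu_prod (- alpha) k = attr_prod D (alpha / 2) k.
  rewrite /mu_prod /attr_prod; apply: eq_bigr => j _.
  by rewrite mulNr opprK.
by rewrite /attr_const !mulNr !mulrN !mulNr opprK.
Qed.

Lemma B_E k : (0 < k)%N ->
  B k = rep_const * ((1 - mu_prod beta k) / ((k%:R - 1) * (k%:R + D - 1))).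
Proof.
move=> k0; rewrite /B_ lambda_sub_lambda1 -opprB mu_sub_mu1//.
by rewrite opprK [RHS]mulrA.
Qed.

Let alpha_ok : 0 <= alpha / 2 /\ 0 < D - 1 - 2 * (alpha / 2).
Proof. have h0 := al0; have h1 := al1; split; lra. Qed.

Let beta_ok :
  3 * D + 1 + alpha / 2 * (D - 1) <= (D - 1 - 2 * (alpha / 2)) * (beta / 2).
Proof.
have h1 := al1; have := best; rewrite /beta_star ler_pdivrMr; lra.
Qed.

Lemma norm_mu_prod k : `|mu_prod beta k| = rep_prod D (beta / 2) k.
Proof.
have hD := D2; have h0 := be0.
rewrite normr_prod /rep_prod; apply: eq_bigr => j _; rewrite normrM normfV; congr (_ / _).
by rewrite ger0_norm//; have := ler0n R j; lra.
Qed.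

(** Both factors [1 - beta / 2] and [2 - beta / 2] are negative beyond the
    threshold. *)
Lemma mu_prod3 : mu_prod beta 3 = rep_prod D (beta / 2) 3.
Proof.
have hD := D2; have [ha haD] := alpha_ok; have hx := beta_ok; have x3 := threshold_gt3 hD ha haD hx; have h0 := be0.
rewrite -norm_mu_prod ger0_norm// /mu_prod big_nat_recr//= big_nat1.
apply: mulr_le0; rewrite mulr_le0_ge0 ?invr_ge0//; lra.
Qed.

Lemma weight_gt0 k : (1 < k)%N -> 0 < (k%:R - 1) * (k%:R + D - 1) :> R.
Proof.
move=> k1; have hD := D2; have k2 : 2 <= k%:R :> R by rewrite (ler_nat _ 2).
by apply: mulr_gt0; lra.
Qed.

Lemma one_sub_attr_prod_gt0 k : (1 < k)%N -> 0 < 1 - attr_prod D (alpha / 2) k.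
Proof.
have hD := D2; have [ha haD] := alpha_ok.
elim: k => // k IHk; rewrite ltnS leq_eqVlt => /orP[/eqP <-|k1].
  by rewrite attr_prodS// attr_prod1 mul1r subr_gt0 ltr_pdivrMr; lra.
apply: lt_le_trans (IHk k1) _; rewrite lerD2l lerN2 -subr_ge0 attr_prod_sub ?(ltnW k1)//.
have k2 : 2 <= k%:R :> R by rewrite (ler_nat _ 2).
rewrite divr_ge0 ?mulr_ge0 ?(ltW haD) ?ltW ?attr_prod_gt0 ?(ltnW k1)//; lra.
Qed.

Lemma one_sub_mu_prod_ge k : 1 - rep_prod D (beta / 2) k <= 1 - mu_prod beta k.
Proof. by rewrite lerD2l lerN2 -norm_mu_prod ler_norm. Qed.

Lemma one_sub_mu_prod_gt0 k : (1 < k)%N -> 0 < 1 - mu_prod beta k.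
Proof.
move=> k1; have hD := D2; have [ha haD] := alpha_ok; have hx := beta_ok.
apply: lt_le_trans (one_sub_mu_prod_ge k); rewrite subr_gt0.
exact: rep_prod_lt1 hD ha haD hx _ k1.
Qed.

Lemma A_gt0 k : (1 < k)%N -> 0 < A k.
Proof.
move=> k1; rewrite A_E ?(ltnW k1)//.
by rewrite mulr_gt0 ?attr_const_gt0// divr_gt0 ?weight_gt0 ?one_sub_attr_prod_gt0.
Qed.

Lemma B_gt0 k : (1 < k)%N -> 0 < B k.
Proof.
move=> k1; rewrite B_E ?(ltnW k1)//.
by rewrite mulr_gt0 ?rep_const_gt0// divr_gt0 ?weight_gt0 ?one_sub_mu_prod_gt0.
Qed.

Lemma A2E : A 2 = attr_const * (D - 1 - alpha) * 2 / ((2 * D - alpha) * (D + 1)).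
Proof.
have hD := D2; have h0 := al0; have h1 := al1.
rewrite A_E// attr_prodS// attr_prod1; field.
by repeat (apply/andP; split); rewrite ?gt_eqF//; lra.
Qed.

Lemma A3E : A 3 = A 2 * ((D + 1) / (2 * D + 2 - alpha)).
Proof.
have hD := D2; have h0 := al0; have h1 := al1; have [ha haD] := alpha_ok.
rewrite A2E A_E// (one_sub_attr_prod3 hD ha haD); field.
by repeat (apply/andP; split); rewrite ?gt_eqF//; lra.
Qed.

Lemma B2E : B 2 = rep_const * (D - 1 + beta) * 2 / ((2 * D + beta) * (D + 1)).
Proof.
have hD := D2; have h0 := be0.
rewrite B_E// /mu_prod big_nat1; field.
by repeat (apply/andP; split); rewrite ?gt_eqF//; lra.
Qed.

Lemma B3E : B 3 = B 2 * ((D + 1) / (2 * D + 2 + beta)).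
Proof.
have hD := D2; have h0 := be0; have [ha haD] := alpha_ok; have hx := beta_ok.
rewrite B2E B_E// mu_prod3 (one_sub_rep_prod3 hD ha haD hx); field.
by repeat (apply/andP; split); rewrite ?gt_eqF//; lra.
Qed.

Lemma A_le_A3 k : (2 < k)%N -> A k <= A 3.
Proof.
move=> k2; have hD := D2; have [ha haD] := alpha_ok.
rewrite !A_E// ?(ltnW (ltnW k2))// ler_pM2l ?attr_const_gt0//.
rewrite ler_pdivrMr ?weight_gt0 ?(ltnW k2)// mulrAC ler_pdivlMr ?weight_gt0//.
have := attr_prod_average hD ha haD k2.
by rewrite (_ : 2 * (D + 2) = (3%:R - 1) * (3%:R + D - 1))//; ring.
Qed.

(** [spectral_ratio], as [1 - p k] is at least [1 - `|p k|] for the signed product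
    [p], with equality at [k = 3]. *)
Lemma A_B_ratio k : (2 < k)%N -> A k * B 3 <= A 3 * B k.
Proof.
move=> k2; have hD := D2; have [ha haD] := alpha_ok; have hx := beta_ok; have k0 := ltnW (ltnW k2).
have := spectral_ratio hD ha haD hx k2 => h.
have {}h : (1 - attr_prod D (alpha / 2) k) * (1 - mu_prod beta 3) <=
   (1 - mu_prod beta k) * (1 - attr_prod D (alpha / 2) 3).
  rewrite mu_prod3; apply: le_trans h _; rewrite ler_wpM2r ?one_sub_mu_prod_ge//.
  by rewrite ltW// one_sub_attr_prod_gt0.
rewrite !A_E// !B_E//.
have := weight_gt0 (ltnW k2); have := weight_gt0 (isT : 1 < 3)%N.
move: (_ * _) (_ * _) => w3 wk w30 wk0.
have c0 : 0 < attr_const * rep_const / (wk * w3).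
  by apply: divr_gt0; apply: mulr_gt0; rewrite ?attr_const_gt0 ?rep_const_gt0.
rewrite -(ler_pM2l c0) in h.
apply: le_trans (le_trans _ h) _; rewrite le_eqVlt; apply/orP; left; apply/eqP.
  by field; rewrite !gt_eqF.
by field; rewrite !gt_eqF.
Qed.

End spectrum.

(** * The critical mass as a ratio of coefficients *)

Section critical_mass.
Context {R : realType}.
Notation K := (Num.sqrt pi : R).
Variable d : nat.
Hypothesis d2 : (2 <= d)%N.
Notation D := (d%:R : R).

Let D2 : 2 <= D. Proof. by rewrite (ler_nat _ 2). Qed.

(** The factors common to [mu] and to the energy of the ball that do not depend
    on the exponent, and therefore cancel between [- alpha] and [beta]. *)
Definition energy_const : R :=
  (D - 1) * omega d.-1 * Gamma ((D - 1) / 2) * K * Gamma (D / 2) /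
  (8 * K ^+ d * K ^+ d).

(** The Gamma values on the two sides differ by unit shifts of their arguments,
    which [GammaD1] turns into the rational factors. *)
Lemma mu_factor_energy (sigma : R) : 0 < D - 1 + sigma ->
  mu_factor d sigma * (D - 1 + sigma) / ((2 * D - 2 + sigma) * (2 * D + sigma)) =
  energy_const * (D + sigma) * riesz_energy_ball d sigma.
Proof.
move=> s0; have hD := D2.
rewrite /mu_factor /riesz_energy_ball /potential_const /energy_const.
have -> : (D + sigma + 1) / 2 = (D - 1 + sigma) / 2 + 1 by field.
have -> : (sigma + 2 * D) / 2 = (2 * D - 2 + sigma) / 2 + 1 by field.
rewrite !GammaD1; [|lra|lra].
have -> : 2 `^ (D + sigma) = 2 `^ (D - 1 + sigma) * 2 :> R.
  rewrite -[X in _ = _ * X](powRr1 (ler0n _ 2)) -gt0_powRD//; congr (_ `^ _); ring.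
have k0 := @gauss_const_gt0 R.
have g0 : 0 < Gamma (D / 2) by apply: Gamma_gt0; lra.
have g2 : 0 < Gamma ((2 * D - 2 + sigma) / 2) by apply: Gamma_gt0; lra.
have kd0 : 0 < K ^+ d by rewrite exprn_gt0.
move: g0 g2 k0 kd0.
move: (K ^+ d) K (2 `^ _) (omega _) => kd k u om.
move: (Gamma _) (Gamma _) (Gamma _) (Gamma _) => a b c e e0 c0 k0 kd0.
field.
by repeat (apply/andP; split); rewrite gt_eqF//; lra.
Qed.

Lemma energy_const_gt0 : 0 < energy_const.
Proof.
have hD := D2; have om : 0 < omega d.-1 :> R.
  by apply: omega_gt0; case: d d2 => [|[]].
have k0 := @gauss_const_gt0 R.
apply: divr_gt0; last by rewrite !mulr_gt0 ?exprn_gt0.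
by rewrite !mulr_gt0 ?Gamma_gt0//; lra.
Qed.

Variables alpha beta : R.
Hypotheses (al0 : 0 < alpha) (al1 : alpha < D - 1) (be0 : 0 < beta).
Hypothesis (best : beta_star d alpha <= beta).

(** [A_ 3] and [B_ 3] are the same function of the exponent up to sign, at
    [- alpha] and at [beta]. *)
Lemma A3_B3_energy :
  alpha * (D - alpha) * (2 * D + 2 + beta) / (beta * (D + beta) * (2 * D + 2 - alpha)) *
    (calJ (- alpha) (@unit_ball R d) / calJ beta (@unit_ball R d)) =
  A_ d alpha 3 / B_ d beta 3.
Proof.
have hD := D2; have h0 := al0; have h1 := al1; have h2 := be0.
have dpos : (0 < d)%N by apply: leq_trans d2.
rewrite !calJ_ball//; try (by rewrite ?oppr_eq0 gt_eqF); try lra.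
have -> : A_ d alpha 3 = 2 * alpha / (2 * D + 2 - alpha) *
    (energy_const * (D - alpha) * riesz_energy_ball d (- alpha)).
  rewrite -mu_factor_energy; last lra.
  rewrite (A3E d2 al0 al1) (A2E d2 al0 al1) /attr_const.
  by field; repeat (apply/andP; split); rewrite gt_eqF//; lra.
have -> : B_ d beta 3 = 2 * beta / (2 * D + 2 + beta) *
    (energy_const * (D + beta) * riesz_energy_ball d beta).
  rewrite -mu_factor_energy; last lra.
  rewrite (B3E d2 al0 al1 be0 best) (B2E d2 be0) /rep_const.
  by field; repeat (apply/andP; split); rewrite gt_eqF//; lra.
have Jb : riesz_energy_ball d beta != 0 :> R.
  by rewrite gt_eqF// riesz_energy_ball_gt0//; lra.
have c0 := lt0r_neq0 energy_const_gt0.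
field; rewrite Jb c0 /=.
by repeat (apply/andP; split); rewrite gt_eqF//; lra.
Qed.

End critical_mass.

(** * The supremum of the curves *)

Section envelope.
Context {R : realType}.

Lemma eps_eq d (alpha beta m : R) k0 : (0 < k0)%N ->
  (forall k, (1 < k)%N -> eps_ d alpha beta k m <= eps_ d alpha beta k0 m) ->
  0 <= eps_ d alpha beta k0 m ->
  eps d alpha beta m = (eps_ d alpha beta k0 m)%:E.
Proof.
move=> k00 le0 ge0; apply/eqP; rewrite eq_le; apply/andP; split.
  apply: ub_ereal_sup => _ [k /= k1 <-]; rewrite lee_fin.
  have [k2|k2] := ltnP 1 k; first exact: le0.
  by have -> : k = 1%N by apply/eqP; rewrite eqn_leq k2.
by apply: ereal_sup_ubound; exists k0.
Qed.

Lemma le_powR_inv (q X m : R) : 0 < q -> 0 <= X -> 0 <= m ->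
  (m <= X `^ q^-1) = (m `^ q <= X).
Proof.
move=> q0 X0 m0; have qi : 0 < q^-1 by rewrite invr_gt0.
have XE : X = (X `^ q^-1) `^ q by rewrite -powRrM mulVf ?gt_eqF// powRr1.
apply/idP/idP => h.
  by rewrite XE; apply: ge0_ler_powR; rewrite ?nnegrE ?powR_ge0 ?(ltW q0).
have -> : m = (m `^ q) `^ q^-1 by rewrite -powRrM mulfV ?gt_eqF// powRr1.
by apply: ge0_ler_powR; rewrite ?nnegrE ?powR_ge0 ?(ltW qi).
Qed.

Lemma powR_inv_le (q X m : R) : 0 < q -> 0 <= X -> 0 <= m ->
  (X `^ q^-1 <= m) = (X <= m `^ q).
Proof.
move=> q0 X0 m0; have qi : 0 < q^-1 by rewrite invr_gt0.
have XE : X = (X `^ q^-1) `^ q by rewrite -powRrM mulVf ?gt_eqF// powRr1.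
apply/idP/idP => h.
  by rewrite XE; apply: ge0_ler_powR; rewrite ?nnegrE ?powR_ge0 ?(ltW q0).
have -> : m = (m `^ q) `^ q^-1 by rewrite -powRrM mulfV ?gt_eqF// powRr1.
by apply: ge0_ler_powR; rewrite ?nnegrE ?powR_ge0 ?(ltW qi).
Qed.

End envelope.

Theorem proposition2p10 (R : realType) (d : nat) (alpha beta : R)
    (hd : (2 <= d)%N) (halpha : 0 < alpha < d%:R - 1) (hbeta : 0 < beta)
    (hbeta_star : beta_star d alpha <= beta) :
  let eps := eps d alpha beta in
  let eps_ := eps_ d alpha beta in
  let m2c := m2c d alpha beta in
  let m23 := m23 d alpha beta in
  let m_star := m_star d alpha beta in
  [/\ (forall m : R, 0 <= m <= m23 -> eps m = (eps_ 2%N m)%:E),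
      (forall m : R, m23 <= m <= m_star -> eps m = (eps_ 3%N m)%:E)
    & (forall m : R, m_star <= m -> eps m = 0%:E)]
  /\ [/\ (forall m m' : R, 0 <= m -> m < m' -> m' <= m2c ->
            (eps m < eps m')%E),
         (forall m m' : R, m2c <= m -> m < m' -> m' <= m_star ->
            (eps m' < eps m)%E)
       & [/\ 0 < m2c, m2c < m23 & m23 < m_star]].
Proof.
move: halpha => /andP[al0 al1].
have D2 : 2 <= d%:R :> R by rewrite (ler_nat _ 2).
have D0 : 0 < d%:R :> R by lra.
pose A := A_ d alpha; pose B := B_ d beta.
have A0 k : (1 < k)%N -> 0 < A k by exact: A_gt0.
have B0 k : (1 < k)%N -> 0 < B k by exact: (B_gt0 hd al0 al1 hbeta hbeta_star).
have r0 : 0 < r_exp d alpha by apply: divr_gt0; lra.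
have q0 : 0 < q_exp d alpha beta by apply: divr_gt0; lra.
have qi0 : 0 < (q_exp d alpha beta)^-1 by rewrite invr_gt0.
have rE : r_exp d alpha / (r_exp d alpha + q_exp d alpha beta) =
    (d%:R + 1 - alpha) / (d%:R + 1 + beta).
  rewrite /r_exp /q_exp; field.
  by repeat (apply/andP; split); rewrite gt_eqF//; lra.
have A2 := A0 2%N isT; have B2 := B0 2%N isT.
have A3 := A0 3%N isT; have B3 := B0 3%N isT.
have EA := A3E hd al0 al1; have EB := B3E hd al0 al1 hbeta hbeta_star.
have [Z ZE] : exists Z, Z = A 2%N / B 2%N by eexists.
have Z0 : 0 < Z by rewrite ZE divr_gt0.
(* the three masses, raised to the power [q], as multiples of [A 2 / B 2] *)
pose Mc := (d%:R + 1 - alpha) / (d%:R + 1 + beta) * Z.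
pose Ms := (2 * d%:R + 2 + beta) / (2 * d%:R + 2 - alpha) * Z.
pose M23 := (d%:R + 1 - alpha) / (d%:R + 1 + beta) * Ms.
have McE : m2c d alpha beta = Mc `^ (q_exp d alpha beta)^-1.
  rewrite /m2c /Mc -rE ZE; congr (_ `^ _); rewrite -/A -/B.
  by rewrite -mulf_div.
have dA : A 2%N - A 3%N = A 2%N * ((d%:R + 1 - alpha) / (2 * d%:R + 2 - alpha)).
  by rewrite /A EA; field; rewrite gt_eqF//; lra.
have dB : B 2%N - B 3%N = B 2%N * ((d%:R + 1 + beta) / (2 * d%:R + 2 + beta)).
  by rewrite /B EB; field; rewrite gt_eqF//; lra.
have M23AB : M23 = (A 2%N - A 3%N) / (B 2%N - B 3%N).
  rewrite dA dB /M23 /Ms ZE; field; rewrite (gt_eqF B2) /=.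
  by repeat (apply/andP; split); rewrite gt_eqF//; lra.
have M23E : m23 d alpha beta = M23 `^ (q_exp d alpha beta)^-1.
  by rewrite /m23 M23AB.
have MsAB : Ms = A 3%N / B 3%N.
  rewrite /Ms ZE /A /B EA EB; field; rewrite (gt_eqF B2) /=.
  by repeat (apply/andP; split); rewrite gt_eqF//; lra.
have MsE : m_star d alpha beta = Ms `^ (q_exp d alpha beta)^-1.
  rewrite /m_star /q_exp invf_div; congr (_ `^ _); rewrite MsAB.
  exact: A3_B3_energy.
have Mc0 : 0 < Mc by rewrite mulr_gt0 ?divr_gt0//; lra.
have Ms0 : 0 < Ms by rewrite mulr_gt0 ?divr_gt0//; lra.
have Mc23 : Mc < M23.
  rewrite /M23 ltr_pM2l; last by rewrite divr_gt0//; lra.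
  by rewrite /Ms -[ltLHS]mul1r ltr_pM2r// ltr_pdivlMr; lra.
have M23s : M23 < Ms.
  by rewrite /M23 -[ltRHS]mul1r ltr_pM2r// ltr_pdivrMr; lra.
have M230 := lt_trans Mc0 Mc23.
have eE k m : (1 < k)%N -> eps_ d alpha beta k m =
    mode_curve (r_exp d alpha) (q_exp d alpha beta) (A k) (B k) m.
  by rewrite /eps_; case: k => [|[|k]].
move=> E E_ m2 m3 ms.
have m20 : 0 < m2 by rewrite /m2 McE powR_gt0.
have m23lt : m2 < m3 by rewrite /m2 /m3 McE M23E gt0_ltr_powR ?nnegrE ?ltW.
have m3slt : m3 < ms by rewrite /ms /m3 MsE M23E gt0_ltr_powR ?nnegrE ?ltW.
have m30 := lt_trans m20 m23lt.
(* all later curves lie below the third one, or below zero *)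
have tail k (M : R) : (2 < k)%N -> 0 <= M ->
    exists2 t, 0 <= t <= 1 & A k - B k * M <= t * (A 3%N - B 3%N * M).
  move=> k2 M0; exists (A k / A 3%N).
    apply/andP; split; first by rewrite divr_ge0 ?(ltW A3) ?(ltW (A0 _ (ltnW k2))).
    by rewrite ler_pdivrMr// mul1r A_le_A3.
  rewrite mulrBr divfK ?gt_eqF// lerD2l lerN2 mulrA ler_wpM2r//.
  by rewrite mulrAC ler_pdivrMr// [leRHS]mulrC (A_B_ratio hd al0 al1 hbeta hbeta_star).
have le3 m k : 0 <= m -> m <= ms -> (2 < k)%N -> E_ k m <= E_ 3%N m.
  move=> m0 mms k2; rewrite /E_ !eE ?(ltnW k2)// /mode_curve ler_wpM2l ?powR_ge0//.
  have [t /andP[t0 t1] tl] := tail k _ k2 (powR_ge0 m (q_exp d alpha beta)).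
  apply: le_trans tl _; rewrite ler_piMl// subr_ge0.
  rewrite mulrC -ler_pdivlMr// -MsAB -le_powR_inv ?(ltW Ms0)// -MsE //.
have ge03 m : 0 <= m -> m <= ms -> 0 <= E_ 3%N m.
  move=> m0 mms; rewrite /E_ eE// mulr_ge0 ?powR_ge0// subr_ge0.
  rewrite mulrC -ler_pdivlMr// -MsAB -le_powR_inv ?(ltW Ms0)// -MsE //.
have cross m : 0 <= m -> (m <= m3 -> E_ 3%N m <= E_ 2%N m) /\
    (m3 <= m -> E_ 2%N m <= E_ 3%N m).
  move=> m0.
  have BB : B 3%N < B 2%N.
    by rewrite /B EB -/B gtr_pMr// ltr_pdivrMr; lra.
  split => h; rewrite /E_ !eE// ler_wpM2l ?powR_ge0//.
    have : m `^ q_exp d alpha beta <= M23 by rewrite -le_powR_inv -?M23E// ltW.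
    by rewrite M23AB ler_pdivlMr ?subr_gt0//; lra.
  have : M23 <= m `^ q_exp d alpha beta by rewrite -powR_inv_le -?M23E// ltW.
  by rewrite M23AB ler_pdivrMr ?subr_gt0//; lra.
have eq2 m : 0 <= m <= m3 -> E m = (E_ 2%N m)%:E.
  move=> /andP[m0 mm3]; have mms := ltW (le_lt_trans mm3 m3slt).
  have e32 := (cross m m0).1 mm3.
  apply: eps_eq => // [k|]; last exact: le_trans (ge03 m m0 mms) e32.
  rewrite leq_eqVlt => /orP[/eqP <-//|k2].
  exact: le_trans (le3 m k m0 mms k2) e32.
have eq3 m : m3 <= m <= ms -> E m = (E_ 3%N m)%:E.
  move=> /andP[mm3 mms]; have m0 := ltW (lt_le_trans m30 mm3).
  apply: eps_eq => // [k|]; last exact: ge03.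
  rewrite leq_eqVlt => /orP[/eqP <-//|k2]; last exact: le3.
  exact: (cross m m0).2 mm3.
have m2q : m2 `^ q_exp d alpha beta = Mc.
  by rewrite /m2 McE -powRrM mulVf ?gt_eqF// powRr1// ltW.
have m3q : m3 `^ q_exp d alpha beta = M23.
  by rewrite /m3 M23E -powRrM mulVf ?gt_eqF// powRr1// ltW.
have rq0 : r_exp d alpha + q_exp d alpha beta != 0 by rewrite gt_eqF// addr_gt0.
have crit2 : r_exp d alpha * A 2%N =
    (r_exp d alpha + q_exp d alpha beta) * B 2%N * m2 `^ q_exp d alpha beta.
  by rewrite m2q /Mc -rE ZE; field; rewrite rq0 gt_eqF.
(* the third curve peaks where it meets the second one *)
have crit3 : r_exp d alpha * A 3%N =
    (r_exp d alpha + q_exp d alpha beta) * B 3%N * m3 `^ q_exp d alpha beta.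
  by rewrite m3q /M23 -rE MsAB; field; rewrite rq0 gt_eqF.
have up2 m m' : 0 <= m -> m < m' -> m' <= m2 -> E_ 2%N m < E_ 2%N m'.
  move=> m0 mm' mc; rewrite /E_ !eE//.
  exact: (mode_curve_increasing r0 q0 B2 crit2 (ltW m20) m0 mm' mc).
have dn2 m m' : m2 <= m -> m < m' -> E_ 2%N m' < E_ 2%N m.
  by move=> mc mm'; rewrite /E_ !eE//; exact: (mode_curve_decreasing r0 q0 B2 crit2 m20 mc mm').
have dn3 m m' : m3 <= m -> m < m' -> E_ 3%N m' < E_ 3%N m.
  by move=> mc mm'; rewrite /E_ !eE//; exact: (mode_curve_decreasing r0 q0 B3 crit3 m30 mc mm').
have le0 m k : ms <= m -> (2 < k)%N -> E_ k m <= 0.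
  move=> mms k2; have m0 : 0 <= m by rewrite (le_trans _ mms)// ltW// (lt_trans m30).
  rewrite /E_ eE ?(ltnW k2)// /mode_curve mulr_ge0_le0 ?powR_ge0//.
  have [t /andP[t0 t1] tl] := tail k _ k2 (powR_ge0 m (q_exp d alpha beta)).
  apply: le_trans tl _; rewrite mulr_ge0_le0// subr_le0.
  by rewrite mulrC -ler_pdivrMr// -MsAB -powR_inv_le ?(ltW Ms0)// -MsE.
split; split => //.
- move=> m mms; have m0 : 0 <= m by apply: le_trans mms; rewrite ltW// (lt_trans m30).
  have e1 : eps_ d alpha beta 1 m = 0 by [].
  rewrite -[X in X%:E]e1; apply: eps_eq => // k; rewrite e1.
  rewrite leq_eqVlt => /orP[/eqP <-|k2]; last exact: le0.
  apply: le_trans (le0 m 3%N mms isT).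
  by apply: (cross m m0).2; rewrite (le_trans (ltW m3slt)).
- move=> m m' m0 mm' m'2.
  rewrite !eq2 ?lte_fin; first exact: up2.
  + by rewrite (le_trans m0 (ltW mm'))/= (le_trans m'2)// ltW.
  + by rewrite m0/= (le_trans (ltW mm'))// (le_trans m'2)// ltW.
- move=> m m' mm mm' m's.
  have m0 : 0 <= m by rewrite (le_trans (ltW m20)).
  have [m'3|m'3] := leP m' m3.
    rewrite !eq2 ?lte_fin; first exact: dn2.
    + by rewrite m0/= (le_trans (ltW mm')).
    + by rewrite (le_trans m0 (ltW mm')).
  have [m3m|m3m] := leP m3 m.
    rewrite !eq3 ?lte_fin; first exact: dn3.
    + by rewrite m3m/= (le_trans (ltW mm')).
    + by rewrite (ltW m'3).
  have I3 : m3 <= m3 <= ms by rewrite lexx ltW.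
  have I3' : m3 <= m' <= ms by rewrite (ltW m'3).
  have I2 : 0 <= m3 <= m3 by rewrite lexx ltW.
  have I2' : 0 <= m <= m3 by rewrite m0 ltW.
  apply: (@lt_trans _ _ (E m3)).
    by rewrite (eq3 _ I3) (eq3 _ I3') lte_fin; exact: dn3.
  by rewrite (eq2 _ I2) (eq2 _ I2') lte_fin; exact: dn2.
Qed.
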